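(* Let $p\ge1$. For every $X\in\Omega^p(V)$, $$\{X\boxplus H: H\in\mathscr H^p(V)\}=\{X\boxplus H: H\in\mathscr H^{\mathrm{am},p}(V)\}.$$
   Context: Setting. $J=[S,T]$ is a fixed compact interval and $\triangle_J=\{(s,t)\in J^2: s\le t\}$. $V$ is a Banach space; $V^{\otimes n}$ ($V^{\otimes 0}=\mathbb R$) denotes its completed tensor powers with admissible norms: permutations in $S_n$ act by isometries on $V^{\otimes n}$, and $\|v\otimes w\|\le\|v\|\|w\|$. $T^{(k)}(V)=\bigoplus_{i=0}^kV^{\otimes i}$ with product $(a\otimes b)^i=\sum_{j=0}^i a^j\otimes b^{i-j}$; $a^i$ is the level-$i$ component. A control on $J$ is a continuous $\omega:\triangle_J\to[0,\infty)$ with $\omega(t,t)=0$ and $\omega(s,u)+\omega(u,t)\le\omega(s,t)$ for $s\le u\le t$. Put $x!:=\Gamma(x+1)$, $\beta(p)=p\bigl(1+\sum_{r=3}^\infty(\frac{2}{r-2})^{(\lfloor p\rfloor+1)/p}\bigr)$. A map $X:\triangle_J\to T^{(k)}(V)$ has finite $p$-variation controlled by $\omega$ with constant $K$ if $\|X^i_{s,t}\|\le K\,\omega(s,t)^{i/p}/(\beta(p)(i/p)!)$ for $i=1,\dots,k$, $(s,t)\in\triangle_J$. A multiplicative functional of degree $k$ is a continuous $X:\triangle_J\to T^{(k)}(V)$ with $X^0\equiv1$ and $X_{s,u}\otimes X_{u,t}=X_{s,t}$ for $s\le u\le t$. $\Omega^{(k,p)}(V)$: those of finite $p$-variation for some control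 and constant; $\Omega^p(V):=\Omega^{(\lfloor p\rfloor,p)}(V)$ ($p$-rough paths). Sewing. For $\theta>1$, $\Omega^{\mathrm{am},(k,p)}_{\theta,\omega}(V)$ is the set of maps $X=(1,X^1,\dots,X^k):\triangle_J\to T^{(k)}(V)$ that for some $K\ge0$ have finite $p$-variation controlled by $\omega$ with constant $K$ and satisfy $\|(X_{s,u}\otimes X_{u,t}-X_{s,t})^i\|\le K\omega(s,t)^\theta$ for $s\le u\le t$, $i=1,\dots,k$. By Lyons' rough sewing lemma, for such $X$ there is a unique multiplicative functional $\bar X$ of degree $k$ with finite $p$-variation such that $\|\bar X^i_{s,t}-X^i_{s,t}\|\le C\omega(s,t)^\theta$ for some $C$ and all $(s,t)$, $i=1,\dots,k$; it is independent of the witnessing $(p,\theta,\omega)$ and denoted $\mathscr S^k(X)$. $\mathscr H^p(V)$ is the set of $H\in\Omega^p(V)$ for which there are a control $\omega$, $\phi\in(1-\frac1p,1]$ and $K\ge0$ with $\|H^j_{s,t}\|\le K\omega(s,t)^\phi$ for $j=1,\dots,\lfloor p\rfloor$, $(s,t)\in\triangle_J$. $\mathscr H^{\mathrm{am},p}(V)$ (almost $\mathscr H$-space) is the set of maps $H$ for which there are a control $\omega$, $\theta>1$, $\phi\in(1-\frac1p,1]$ and $K>0$ with $H\in\Omega^{\mathrm{am},(\lfloor p\rfloor,p)}_{\theta,\omega}(V)$ and $\|H^j_{s,t}\|\le K\omega(s,t)^\phi$ for $j=1,\dots,\lfloor p\rfloor$, $(s,t)\in\triangle_J$. It contains $\mathscr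 H^p(V)$. For $X\in\Omega^p(V)$, $H\in\mathscr H^{\mathrm{am},p}(V)$ let $(X\oplus H)_{s,t}:=(1,X^1_{s,t}+H^1_{s,t},\dots,X^{\lfloor p\rfloor}_{s,t}+H^{\lfloor p\rfloor}_{s,t})$; this lies in $\Omega^{\mathrm{am},(\lfloor p\rfloor,p)}_{\theta',\omega'}(V)$ for some $\theta'>1$ and control $\omega'$, and $X\boxplus H:=\mathscr S^{\lfloor p\rfloor}(X\oplus H)\in\Omega^p(V)$. *)

(* Defs.v *)
From mathcomp Require Import all_boot all_order all_algebra all_fingroup.
From mathcomp Require Import all_classical all_reals all_analysis.

Set Implicit Arguments.
Unset Strict Implicit.
Unset Printing Implicit Defensive.

Import Order.TTheory GRing.Theory Num.Theory.
Import numFieldNormedType.Exports.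

Local Open Scope classical_set_scope.
Local Open Scope ring_scope.

Definition tuple_upd (V : Type) n (v : n.-tuple V) (i : 'I_n) (x : V) :
    n.-tuple V :=
  [tuple if j == i then x else tnth v j | j < n].

Definition multilinear (R : realType) (V W : lmodType R) n
    (f : n.-tuple V -> W) : Prop :=
  forall (i : 'I_n) (v : n.-tuple V), linear (fun x => f (tuple_upd v i x)).

(* The completed tensor powers of V.  [tpow n] is a completion of the algebraic
   n-th tensor power: by [pure_universal] the linear span of the range of
   [pure n] is (a copy of) the algebraic tensor power, and this span is dense.
   The clauses [norm_pure0] and [norm_pure1] express that the 0-th power is the
   scalar field (with unit [pure [tuple]]) and the first power is V,
   isometrically.  The last two clauses are the admissibility of the norms.
   Associativity and unitality of [tmul] follow from [tmul_pure], bilinearity,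
   continuity and density. *)
Record tensor_powers (R : realType) (V : completeNormedModType R) := TensorPowers {
  tpow : nat -> completeNormedModType R;
  pure : forall n, n.-tuple V -> tpow n;
  pure_multilinear : forall n, multilinear (@pure n);
  pure_universal : forall n (W : lmodType R) (f : n.-tuple V -> W),
    multilinear f ->
    exists g : {linear tpow n -> W}, forall v, g (pure v) = f v;
  pure_dense : forall n,
    dense [set x : tpow n | exists (m : nat) (c : 'I_m -> R)
             (v : 'I_m -> n.-tuple V), x = \sum_(l < m) c l *: pure (v l)];
  norm_pure0 : `|pure [tuple]| = 1;
  norm_pure1 : forall x : V, `|pure [tuple x]| = `|x|;
  tmul : forall m n, tpow m -> tpow n -> tpow (m + n);
  tmul_linearl : forall m n (y : tpow n), linear (fun x : tpow m => tmul x y);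
  tmul_linearr : forall m n (x : tpow m), linear (fun y : tpow n => tmul x y);
  tmul_pure : forall m n (v : m.-tuple V) (w : n.-tuple V),
    tmul (pure v) (pure w) = pure [tuple of v ++ w];
  norm_tmul : forall m n (x : tpow m) (y : tpow n),
    `|tmul x y| <= `|x| * `|y|;
  perm_isometry : forall n (s : 'S_n), exists g : {linear tpow n -> tpow n},
    (forall v, g (pure v) = pure [tuple tnth v (s j) | j < n]) /\
    (forall x, `|g x| = `|x|)
}.

Section Defs.
Context {R : realType} {V : completeNormedModType R} (E : tensor_powers V).

(* T^(k)(V), with the topology of the finite direct sum *)
Definition trunc_alg (k : nat) : Type :=
  prod_topology (fun i : 'I_k.+1 => tpow E i).

Definition trunc_one {k} : trunc_alg k := fun i : 'I_k.+1 =>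
  match nat_of_ord i as n return tpow E n with
  | 0%N => pure E [tuple]
  | _.+1 => 0
  end.

(* level i : \sum_(j <= i) a^j (x) b^(i - j); the cast is along
   j + (i - j) = i *)
Definition trunc_mul k (a b : trunc_alg k) : trunc_alg k := fun i : 'I_k.+1 =>
  \sum_(j < i.+1)
    ecast n (tpow E n) (subnKC (leq_ord j))
      (tmul (a (widen_ord (ltn_ord i) j))
            (b (widen_ord (ltn_ord i) (sub_ord j)))).

(* A map on the simplex is encoded as a total function of the pair (s, t),
   of which only the values on the simplex matter. *)
Definition simplex (S T : R) : set (R * R) :=
  [set st | S <= st.1 /\ st.1 <= st.2 /\ st.2 <= T].

Definition is_control (S T : R) (w : R * R -> R) : Prop :=
  [/\ {within simplex S T, continuous w},
      (forall st, simplex S T st -> 0 <= w st),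
      (forall t, S <= t <= T -> w (t, t) = 0) &
      (forall s u t, S <= s -> s <= u -> u <= t -> t <= T ->
         w (s, u) + w (u, t) <= w (s, t))].

Definition Gamma (x : R) : R :=
  \int[lebesgue_measure]_(t in `]0, +oo[) (t `^ (x - 1) * expR (- t)).

Definition rfact (x : R) : R := Gamma (x + 1).

Definition beta_const (p : R) : R :=
  p * (1 + limn (fun n => \sum_(3 <= r < n)
    (2 / (r%:R - 2)) `^ ((Num.truncn p).+1%:R / p))).

Section Maps.
Variables (S T : R) (k : nat).
Implicit Types (X Y : R * R -> trunc_alg k) (w : R * R -> R).

Definition pvar_controlled (p : R) w (K : R) X : Prop :=
  forall (i : 'I_k.+1), (0 < i)%N -> forall st, simplex S T st ->
    `|X st i| <= K * w st `^ (i%:R / p) / (beta_const p * rfact (i%:R / p)).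

Definition unital X : Prop :=
  forall st, simplex S T st -> X st ord0 = pure E [tuple].

Definition mult_functional X : Prop :=
  [/\ {within simplex S T, continuous X}, unital X &
      forall s u t, S <= s -> s <= u -> u <= t -> t <= T ->
        trunc_mul (X (s, u)) (X (u, t)) = X (s, t)].

(* Omega^(k,p) *)
Definition Omega (p : R) : set (R * R -> trunc_alg k) :=
  [set X | mult_functional X /\
    exists w K, [/\ is_control S T w, 0 <= K & pvar_controlled p w K X]].

(* Omega^{am,(k,p)}_{theta,w} *)
Definition Omega_am (p theta : R) w : set (R * R -> trunc_alg k) :=
  [set X | unital X /\ exists K, [/\ 0 <= K, pvar_controlled p w K X &
    forall s u t, S <= s -> s <= u -> u <= t -> t <= T ->
      forall i : 'I_k.+1, (0 < i)%N ->
        `|trunc_mul (X (s, u)) (X (u, t)) i - X (s, t) i|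
          <= K * w (s, t) `^ theta]].

Definition is_sewing X Y : Prop :=
  exists p theta w, [/\ 1 <= p, 1 < theta, is_control S T w,
    Omega_am p theta w X & Omega p Y /\
    exists C, forall st, simplex S T st -> forall i : 'I_k.+1, (0 < i)%N ->
      `|Y st i - X st i| <= C * w st `^ theta].

(* For an almost multiplicative X, all Y with [is_sewing X Y] coincide on the
   simplex; [sewing X] is one of them. *)
Definition sewing X : R * R -> trunc_alg k := xget X [set Y | is_sewing X Y].

Definition oplus X Y : R * R -> trunc_alg k := fun st i =>
  if i == ord0 then trunc_one i else X st i + Y st i.

Definition boxplus X H : R * R -> trunc_alg k := sewing (oplus X H).

(* The map on the simplex underlying X, in normal form: two total functions
   have the same [on_simplex] iff they agree on the simplex. *)
Definition on_simplex X : R * R -> trunc_alg k :=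
  patch (fun=> trunc_one) (simplex S T) X.

Definition level_bound w (phi K : R) X : Prop :=
  forall i : 'I_k.+1, (0 < i)%N -> forall st, simplex S T st ->
    `|X st i| <= K * w st `^ phi.

End Maps.

Definition rough_path (S T p : R) :
    set (R * R -> trunc_alg (Num.truncn p)) :=
  Omega S T p.
Arguments rough_path S T p _ : clear implicits.

Definition Hspace (S T p : R) : set (R * R -> trunc_alg (Num.truncn p)) :=
  [set H | rough_path S T p H /\
    exists w phi K, [/\ is_control S T w, 1 - p^-1 < phi <= 1, 0 <= K &
      level_bound S T w phi K H]].

Definition almost_Hspace (S T p : R) :
    set (R * R -> trunc_alg (Num.truncn p)) :=
  [set H | exists w theta phi K,
    [/\ is_control S T w, 1 < theta, 1 - p^-1 < phi <= 1, 0 < K &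
      Omega_am S T p theta w H /\ level_bound S T w phi K H]].

End Defs.

Arguments rough_path {R V} E S T p _.
Arguments Hspace {R V} E S T p _.
Arguments almost_Hspace {R V} E S T p _.

(* Main.v *)
Require Import Defs.
From mathcomp Require Import all_boot all_order all_algebra all_fingroup.
From mathcomp Require Import all_classical all_reals all_analysis.
From mathcomp Require Import measurable_realfun ring lra.
Local Open Scope classical_set_scope.
Local Open Scope ring_scope.

(** One inclusion holds because an element of the H-space is an element of the
    almost H-space ([Hspace_sub_almost]).  For the other, let [H] be in the almost
    H-space and let [H'] be its sewing.  Then [H'] is multiplicative and differs
    from [H] by [O(w `^ theta)] with [theta > 1], so it satisfies the level bounds of
    [H] and lies in the H-space ([almost_Hspace_sewing]).  Moreover [oplus X H] and
    [oplus X H'] are both almost multiplicative ([oplus_almost]) and differ by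
    [O(w `^ theta)], so their sewings are multiplicative functionals that differ by
    the same order; such functionals coincide ([multiplicative_unique]), whence
    [boxplus X H = boxplus X H'] on the simplex ([boxplus_eq]).

    The substance is the existence of the sewing ([rough_sewing]).  It is built
    level by level: when Chen's identity holds below level [i], associativity of
    the tensor product turns the problem at level [i] into sewing a map with
    values in a Banach space to an additive one ([multiplicative_step]).  That
    additive case ([additive_sewing]) is solved by bisecting intervals with respect
    to the control.  The resulting functional has finite [p]-variation because the
    normalising factors are positive ([rfact_gt0], [beta_const_gt0]), and finite
    [p]-variation together with Chen's identity makes it continuous
    ([multiplicative_continuous]).

    Products of tensors of varying degrees are handled through [gmul], the tensor
    product followed by projection to a given degree. *)

Set Implicit Arguments.
Unset Strict Implicit.
Unset Printing Implicit Defensive.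
Import Order.TTheory GRing.Theory Num.Theory.
Import numFieldNormedType.Exports.

(** * Powers of real numbers *)

Section RealPowers.
Context {R : realType}.
Implicit Types x y q r s : R.

Lemma ler_powR_base r x y : 0 <= r -> 0 <= x -> x <= y -> x `^ r <= y `^ r.
Proof.
move=> r0 x0 xy; apply: ge0_ler_powR => //; rewrite nnegrE//.
exact: le_trans xy.
Qed.

Lemma powRD_gt0 x r s : 0 <= r -> 0 < s -> x `^ (r + s) = x `^ r * x `^ s.
Proof. by move=> r0 s0; rewrite powRD// gt_eqF// ltr_wpDl. Qed.

Lemma powRD_superadd q x y : 1 <= q -> 0 <= x -> 0 <= y ->
  x `^ q + y `^ q <= (x + y) `^ q.
Proof.
move=> q1 x0 y0; have q0 : 0 < q := lt_le_trans ltr01 q1.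
rewrite -(mulr_powRB1 x0 q0) -(mulr_powRB1 y0 q0).
rewrite -(mulr_powRB1 (addr_ge0 x0 y0) q0) mulrDl.
by rewrite lerD// ler_wpM2l// ler_powR_base ?lerDl ?lerDr// subr_ge0.
Qed.

(** On a bounded range a higher power is at most a constant times a lower one;
    every passage to a smaller exponent below goes through this. *)
Lemma ler_powR_exponent x M r s : 0 <= r -> r <= s -> 0 <= x -> x <= M ->
  x `^ s <= M `^ (s - r) * x `^ r.
Proof.
move=> r0; rewrite le_eqVlt => /predU1P[<-|rs] x0 xM; first by rewrite subrr powRr0 mul1r.
have -> : x `^ s = x `^ (s - r) * x `^ r.
  by rewrite mulrC -powRD_gt0 ?subr_gt0// addrC subrK.
by rewrite ler_wpM2r ?powR_ge0// ler_powR_base// subr_ge0 ltW.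
Qed.

Lemma half_powR_lt1 r : 0 < r -> 2^-1 `^ r < 1.
Proof.
move=> r0; have : 2^-1 `^ r < 1 `^ r :> R.
  by apply: gt0_ltr_powR; rewrite ?nnegrE ?invf_lt1 ?ltr1n.
by rewrite powR1.
Qed.

(** The contraction factor of the bisection arguments: halving an interval doubles
    the number of terms and divides each [w `^ q] by at least [2 `^ q]. *)
Lemma double_half_powR_lt1 q : 1 < q -> 2 * 2^-1 `^ q < 1.
Proof.
move=> q1; have q0 : 0 < q by exact: lt_trans q1.
have := @half_powR_lt1 (q - 1); rewrite subr_gt0 => /(_ q1) h.
have := @mulr_powRB1 R 2^-1 q; rewrite invr_ge0 ler0n => /(_ isT q0) <-; lra.
Qed.

Lemma powR_half_le x y q : 0 <= q -> 0 <= x -> x <= y / 2 ->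
  x `^ q <= 2^-1 `^ q * y `^ q.
Proof.
move=> q0 x0 xy; have y0 : 0 <= y by lra.
by rewrite -powRM// ?invr_ge0// mulrC ler_powR_base.
Qed.

End RealPowers.

(** * Controls *)

Section Control.
Context {R : realType}.
Variables (S T : R) (w : R * R -> R).
Hypothesis cw : is_control S T w.

Lemma control_ge0 s t : S <= s -> s <= t -> t <= T -> 0 <= w (s, t).
Proof. by case: cw => _ w0 _ _ Ss st tT; apply: w0; split. Qed.

Lemma control_le s s' t' t : S <= s -> s <= s' -> s' <= t' -> t' <= t -> t <= T ->
  w (s', t') <= w (s, t).
Proof.
move=> Ss ss' s't' t't tT; case: (cw) => _ _ _ wadd.
have h1 := wadd s s' t Ss ss' (le_trans s't' t't) tT.
have h2 := wadd s' t' t (le_trans Ss ss') s't' t't tT.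
have h3 := control_ge0 Ss ss' (le_trans s't' (le_trans t't tT)).
have h4 := control_ge0 (le_trans Ss (le_trans ss' s't')) t't tT.
lra.
Qed.

(** Continuity gives a point [m] with [w (a, m) = w (a, b) / 2], and
    superadditivity then bounds [w (m, b)] as well.  Bisecting with respect to
    [w] rather than to time yields estimates in terms of [w] alone. *)
Lemma control_midpoint a b : S <= a -> a <= b -> b <= T ->
  exists m, [/\ a <= m, m <= b, w (a, m) <= w (a, b) / 2 &
                w (m, b) <= w (a, b) / 2].
Proof.
move=> Sa ab bT; case: (cw) => wc _ wd wadd.
have fc : {within `[a, b], continuous (fun u => w (a, u))}.
  apply/subspace_continuousP => u; rewrite /= in_itv/= => /andP[au ub].
  move/subspace_continuousP : wc => /(_ (a, u)) wc.
  have {wc} : w @ within (simplex S T) (nbhs (a, u)) --> w (a, u).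
    by apply: wc; split => //=; split => //; exact: le_trans bT.
  apply: cvg_comp; move=> /= P; rewrite /within/= /nbhs/=.
  move=> [[/= A B] [Aa Bu] AB].
  rewrite /nbhs /= /filter_from/=.
  apply: filterS Bu => v Bv; rewrite in_itv/= => /andP[av vb].
  apply: (AB (a, v)) => /=; first by split => //; exact: nbhs_singleton.
  by split => //=; split => //; exact: le_trans bT.
have w00 : w (a, a) = 0 by apply: wd; rewrite Sa (le_trans ab bT).
have wab := control_ge0 Sa ab bT.
have [|m] := IVT (v := w (a, b) / 2) ab fc.
  rewrite w00; apply/andP; split.
    by rewrite ge_min divr_ge0.
  by rewrite le_max; apply/orP; right; lra.
rewrite in_itv/= => /andP[am mb] wm; exists m; split => //; first by rewrite wm.
have := wadd a m b Sa am mb bT; rewrite wm; lra.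
Qed.

End Control.

Section Simplex.
Context {R : realType}.
Variables (S T : R).

Lemma simplexP s t : simplex S T (s, t) <-> [/\ S <= s, s <= t & t <= T].
Proof. by split=> [[/= ? []]|[]]. Qed.

Lemma control_leST w s t : is_control S T w -> simplex S T (s, t) ->
  0 <= w (s, t) <= w (S, T).
Proof.
move=> cw /simplexP[Ss st tT].
by rewrite (control_ge0 cw)//= (control_le cw).
Qed.

Lemma control_pow_le w (theta theta' x s t : R) : is_control S T w ->
  0 <= theta' -> theta' <= theta -> simplex S T (s, t) -> 0 <= x -> x <= w (s, t) ->
  x `^ theta <= w (S, T) `^ (theta - theta') * w (s, t) `^ theta'.
Proof.
move=> cw th'0 thth' hst x0 xw; have /andP[_ wW] := control_leST cw hst.
apply: (le_trans (ler_powR_exponent th'0 thth' x0 (le_trans xw wW))).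
by rewrite ler_wpM2l ?powR_ge0// ler_powR_base.
Qed.

Lemma is_controlD (w1 w2 : R * R -> R) : is_control S T w1 -> is_control S T w2 ->
  is_control S T (fun x => w1 x + w2 x).
Proof.
move=> [c1 p1 d1 a1] [c2 p2 d2 a2]; split.
- by move=> x; apply: continuousD; [exact: c1|exact: c2].
- by move=> st h; rewrite addr_ge0 ?p1 ?p2.
- by move=> t h; rewrite d1// d2// addr0.
- move=> s u t h1 h2 h3 h4; have := a1 _ _ _ h1 h2 h3 h4.
  have := a2 _ _ _ h1 h2 h3 h4; lra.
Qed.

Lemma control_addl (w w' : R * R -> R) st : is_control S T w -> is_control S T w' ->
  simplex S T st -> 0 <= w st <= w st + w' st.
Proof.
by move=> [_ w0 _ _] [_ w'0 _ _] hst; rewrite w0//= lerDl w'0.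
Qed.

Lemma control_addr (w w' : R * R -> R) st : is_control S T w -> is_control S T w' ->
  simplex S T st -> 0 <= w' st <= w st + w' st.
Proof.
by move=> [_ w0 _ _] [_ w'0 _ _] hst; rewrite w'0//= lerDr w0.
Qed.

End Simplex.

(** * Sewing of additive maps *)

Section Sewing.
Context {R : realType}.

Lemma cvg_geometric_increments (W : completeNormedModType R) (u : nat -> W)
  (c r : R) : 0 <= c -> 0 <= r < 1 ->
  (forall n, `|u n.+1 - u n| <= c * r ^+ n) -> cvgn u.
Proof.
move=> c0 /andP[r0 r1] hu.
have -> : u = (fun n => u 0%N + series (telescope u) n).
  by apply/funext => n; exact: eq_sum_telescope.
apply: is_cvgD; first exact: is_cvg_cst.
apply: normed_cvg; apply: (@series_le_cvg _ _ (geometric c r)) => //=.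
- by move=> n; rewrite geometric_ge0.
- by apply: is_cvg_geometric_series; rewrite ger0_norm.
Qed.

Section AdditiveSewing.
Variables (S T : R) (w : R * R -> R) (W : completeNormedModType R).
Variables (Xi : R * R -> W) (C theta theta' : R).
Hypotheses (cw : is_control S T w) (C0 : 0 <= C).
Hypotheses (theta'1 : 1 <= theta') (theta'_lt : theta' < theta).
Hypothesis defect : forall s u t, S <= s -> s <= u -> u <= t -> t <= T ->
  `|Xi (s, u) + Xi (u, t) - Xi (s, t)| <= C * w (s, t) `^ theta.

(** The [n]-th approximation at [t] of the sewn path that starts at [a]: the sum of
    [Xi] over the cells of the [n]-fold bisection of the interval from [a] to [b],
    the cell that contains [t] being cut off at [t] and the later ones dropped. *)
Fixpoint bisect_sum (mid : R -> R -> R) n a b t : W :=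
  if n is n'.+1 then
    let m := mid a b in
    if t <= m then bisect_sum mid n' a m t
    else bisect_sum mid n' a m m + bisect_sum mid n' m b t
  else Xi (a, t).

Let theta_gt1 : 1 < theta. Proof. exact: le_lt_trans theta'_lt. Qed.
Let theta_gt0 : 0 < theta. Proof. exact: lt_trans theta_gt1. Qed.

Let Xi_diag s : S <= s -> s <= T -> Xi (s, s) = 0.
Proof.
move=> Ss sT; have := defect Ss (lexx s) (lexx s) sT.
case: (cw) => _ _ wd _; rewrite wd ?Ss//.
by rewrite powR0 ?gt_eqF// mulr0 addrK normr_le0 => /eqP.
Qed.

Let eta := theta - theta'.
Let h : R := 2^-1 `^ eta.
Let r : R := 2 * 2^-1 `^ theta.
(* [K] is the fixed point of [x |-> h * x + C]. *)
Let K : R := C / (1 - h).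

Let h1 : h < 1. Proof. by apply: half_powR_lt1; rewrite subr_gt0. Qed.
Let h0 : 0 <= h. Proof. exact: powR_ge0. Qed.
Let r0 : 0 <= r. Proof. by rewrite mulr_ge0// powR_ge0. Qed.
Let r1 : r < 1. Proof. exact: double_half_powR_lt1. Qed.
Let K0 : 0 <= K. Proof. by rewrite divr_ge0// subr_ge0 ltW. Qed.
Let KE : K * h + C = K.
Proof. by rewrite /K; field; rewrite subr_eq0 gt_eqF. Qed.

Section Mid.
Variable mid : R -> R -> R.
Hypothesis midP : forall a b, S <= a -> a <= b -> b <= T ->
  [/\ a <= mid a b, mid a b <= b, w (a, mid a b) <= w (a, b) / 2 &
      w (mid a b, b) <= w (a, b) / 2].

Lemma bisect_sum_left n a b : S <= a -> a <= b -> b <= T ->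
  bisect_sum mid n a b a = 0.
Proof.
elim: n a b => [|n IH] a b Sa ab bT /=; first by rewrite Xi_diag// (le_trans ab).
have [am mb _ _] := midP Sa ab bT.
by rewrite am IH// (le_trans mb).
Qed.

(** Refining once replaces the value of [Xi] on each cell before [t] by the sum over
    its two parts.  There are at most [2 ^ n] cells, each with a defect of order
    [(2^-1 `^ theta) ^+ n], so the increments are geometric of ratio [r]. *)
Lemma bisect_sum_increment n a b t : S <= a -> a <= t -> t <= b -> b <= T ->
  `|bisect_sum mid n.+1 a b t - bisect_sum mid n a b t|
    <= C * w (a, b) `^ theta * r ^+ n.
Proof.
have th0 := ltW theta_gt0.
elim: n a b t => [|n IH] a b t Sa at_ tb bT.
  have [am mb _ _] := midP Sa (le_trans at_ tb) bT; rewrite /= expr0 mulr1.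
  case: ifPn => [_|]; first by rewrite subrr normr0 mulr_ge0// powR_ge0.
  rewrite -ltNge => /ltW mt.
  rewrite (le_trans (defect Sa am mt (le_trans tb bT)))// ler_wpM2l//.
  rewrite ler_powR_base// ?(control_ge0 cw) ?(le_trans tb)//.
  exact: (control_le cw).
have ab := le_trans at_ tb.
have [am mb wam wmb] := midP Sa ab bT.
have mT := le_trans mb bT; have Sm := le_trans Sa am.
have E1 := powR_half_le th0 (control_ge0 cw Sa am mT) wam.
have E2 := powR_half_le th0 (control_ge0 cw Sm mb bT) wmb.
have rn : 0 <= C * r ^+ n by rewrite mulr_ge0// exprn_ge0.
set x := w (a, b) `^ theta in E1 E2 *.
have x0 : 0 <= x := powR_ge0 _ _.
have g0 : 0 <= 2^-1 `^ theta :> R := powR_ge0 _ _.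
have -> : C * x * r ^+ n.+1 = C * r ^+ n * (2^-1 `^ theta * x) *+ 2.
  by rewrite exprS /r; ring.
have F1 := ler_wpM2l rn E1; have F2 := ler_wpM2l rn E2.
have -> : bisect_sum mid n.+2 a b t = if t <= mid a b then
   bisect_sum mid n.+1 a (mid a b) t else
   bisect_sum mid n.+1 a (mid a b) (mid a b) + bisect_sum mid n.+1 (mid a b) b t by [].
have -> : bisect_sum mid n.+1 a b t = if t <= mid a b then
   bisect_sum mid n a (mid a b) t else
   bisect_sum mid n a (mid a b) (mid a b) + bisect_sum mid n (mid a b) b t by [].
case: ifPn => [tm|].
  rewrite (le_trans (IH a (mid a b) t Sa at_ tm mT))//.
  rewrite mulrAC (le_trans F1)// mulr2n lerDl.
  by rewrite mulr_ge0// mulr_ge0.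
rewrite -ltNge => /ltW mt; rewrite opprD addrACA (le_trans (ler_normD _ _))//.
rewrite mulr2n lerD//.
  by rewrite (le_trans (IH a (mid a b) (mid a b) Sa am _ mT))// mulrAC.
by rewrite (le_trans (IH (mid a b) b t Sm mt tb bT))// mulrAC.
Qed.

(** When [m] separates [s] from [t], the two halves contribute
    [w (s, m) `^ theta' + w (m, t) `^ theta' <= w (s, t) `^ theta'] times
    [(w (a, b) / 2) `^ eta], and the spare exponent [eta = theta - theta'] leaves
    a factor [h < 1] that absorbs the new defect [C * w (s, t) `^ theta].  Trading
    [theta] for a smaller [theta'] thus replaces the estimate over arbitrary
    partitions by a single induction on [n]. *)
Lemma bisect_sum_close n a b s t :
  S <= a -> a <= s -> s <= t -> t <= b -> b <= T ->
  `|bisect_sum mid n a b t - bisect_sum mid n a b s - Xi (s, t)|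
    <= K * w (s, t) `^ theta' * w (a, b) `^ eta + C * w (a, b) `^ theta * r ^+ n.
Proof.
have th0 := ltW theta_gt0.
have eta0 : 0 <= eta by rewrite subr_ge0 ltW.
elim: n a b s t => [|n IH] a b s t Sa as_ st tb bT.
  have Ss := le_trans Sa as_; have tT := le_trans tb bT.
  rewrite /= expr0 mulr1 -addrA -opprD distrC.
  rewrite (le_trans (defect Sa as_ st tT))//.
  rewrite -[X in X <= _]add0r lerD//.
    by apply: mulr_ge0; [apply: mulr_ge0 => //|]; exact: powR_ge0.
  rewrite ler_wpM2l// ler_powR_base//; first by rewrite (control_ge0 cw)// (le_trans as_).
  by apply: (control_le cw) => //; exact: le_trans st.
have ab := le_trans as_ (le_trans st tb).
have [am mb wam wmb] := midP Sa ab bT.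
have Ss := le_trans Sa as_; have tT := le_trans tb bT.
have mT := le_trans mb bT; have Sm := le_trans Sa am.
have E1 := powR_half_le th0 (control_ge0 cw Sa am mT) wam.
have E2 := powR_half_le th0 (control_ge0 cw Sm mb bT) wmb.
have G1 := powR_half_le eta0 (control_ge0 cw Sa am mT) wam.
have G2 := powR_half_le eta0 (control_ge0 cw Sm mb bT) wmb.
have rn : 0 <= C * r ^+ n by rewrite mulr_ge0// exprn_ge0.
have g0 : 0 <= 2^-1 `^ theta :> R := powR_ge0 _ _.
have x0 : 0 <= w (a, b) `^ theta := powR_ge0 _ _.
have y0 : 0 <= w (a, b) `^ eta := powR_ge0 _ _.
have F1 := ler_wpM2l rn E1; have F2 := ler_wpM2l rn E2.
have KQ (q x : R) : 0 <= q -> x <= h * w (a, b) `^ eta ->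
    K * q * x <= K * h * q * w (a, b) `^ eta.
  by move=> q0 xh; rewrite [K * h * q]mulrAC -[leRHS]mulrA ler_wpM2l// mulr_ge0.
have -> : C * w (a, b) `^ theta * r ^+ n.+1 =
    C * r ^+ n * (2^-1 `^ theta * w (a, b) `^ theta) *+ 2.
  by rewrite exprS /r; ring.
have d0 : 0 <= C * r ^+ n * (2^-1 `^ theta * w (a, b) `^ theta).
  by rewrite mulr_ge0// mulr_ge0.
have KK : K * h * w (s, t) `^ theta' * w (a, b) `^ eta <=
    K * w (s, t) `^ theta' * w (a, b) `^ eta.
  by rewrite ler_wpM2r// ler_wpM2r ?powR_ge0// ler_piMr// ltW.
rewrite /= mulr2n.
case: ifPn => [tm|].
  rewrite (le_trans st tm).
  rewrite (le_trans (IH a (mid a b) s t Sa as_ st tm mT))// lerD//.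
    by rewrite (le_trans (KQ _ _ (powR_ge0 _ _) G1)).
  by rewrite mulrAC (le_trans F1)// lerDl.
rewrite -ltNge => /ltW mt; case: ifPn => [sm|]; last first.
  rewrite -ltNge => /ltW ms; rewrite opprD addrACA subrr add0r.
  rewrite (le_trans (IH (mid a b) b s t Sm ms st tb bT))// lerD//.
    by rewrite (le_trans (KQ _ _ (powR_ge0 _ _) G2)).
  by rewrite mulrAC (le_trans F2)// lerDl.
have H1 := IH a (mid a b) s (mid a b) Sa as_ sm (lexx _) mT.
have H2 := IH (mid a b) b (mid a b) t Sm (lexx _) mt tb bT.
have H3 := defect Ss sm mt tT.
rewrite bisect_sum_left// subr0 in H2.
set A := bisect_sum _ _ _ _ _ in H1 *; set B := bisect_sum _ _ _ _ s in H1 *.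
set D := bisect_sum _ _ _ _ t in H2 *.
have -> : A + D - B - Xi (s, t) = (A - B - Xi (s, mid a b)) +
    (D - Xi (mid a b, t)) + (Xi (s, mid a b) + Xi (mid a b, t) - Xi (s, t)).
  rewrite [A + D - B]addrAC !addrA; congr (_ - _).
  rewrite [_ - Xi (s, mid a b) + D]addrAC.
  by rewrite [_ - Xi (mid a b, t) + _]addrAC subrK subrK.
rewrite (le_trans (ler_normD _ _))// (le_trans (lerD (ler_normD _ _) (lexx _)))//.
have wst : C * w (s, t) `^ theta <= C * w (s, t) `^ theta' * w (a, b) `^ eta.
  rewrite -mulrA ler_wpM2l// [leRHS]mulrC.
  apply: ler_powR_exponent => //.
  - exact: le_trans theta'1.
  - exact: ltW.
  - exact: (control_ge0 cw).
  - exact: (control_le cw).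
have wadd : w (s, mid a b) `^ theta' + w (mid a b, t) `^ theta' <= w (s, t) `^ theta'.
  rewrite (le_trans (powRD_superadd theta'1 _ _)) ?(control_ge0 cw)//.
  rewrite ler_powR_base ?addr_ge0 ?(control_ge0 cw)//; first exact: le_trans theta'1.
  by case: cw => _ _ _; apply.
have Kh0 : 0 <= K * h * w (a, b) `^ eta by do 2!apply: mulr_ge0 => //.
have := ler_wpM2l Kh0 wadd.
have L1 := KQ _ _ (powR_ge0 (w (s, mid a b)) theta') G1.
have L2 := KQ _ _ (powR_ge0 (w (mid a b, t)) theta') G2.
rewrite mulrAC in H1; rewrite [C * _ * r ^+ n]mulrAC in H2.
rewrite [C * w (a, mid a b) `^ theta * r ^+ n]mulrAC in H1.
have -> : K * w (s, t) `^ theta' * w (a, b) `^ eta =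
  K * h * w (a, b) `^ eta * w (s, t) `^ theta' + C * w (s, t) `^ theta' * w (a, b) `^ eta.
  by rewrite -[X in X * w (s, t) `^ theta']KE; ring.
rewrite mulrDr; lra.
Qed.

End Mid.

(** The bisection sums from [S] to [T] converge to a path [y]; its increments
    [y t - y s] are additive by construction and inherit the estimate that is
    uniform in [n]. *)
Lemma additive_sewing : exists I : R * R -> W,
  (forall s u t, S <= s -> s <= u -> u <= t -> t <= T -> I (s, u) + I (u, t) = I (s, t)) /\
  exists2 D, 0 <= D & forall s t, S <= s -> s <= t -> t <= T ->
    `|I (s, t) - Xi (s, t)| <= D * w (s, t) `^ theta'.
Proof.
have /choice[mid midP] : forall ab : R * R, exists m, S <= ab.1 -> ab.1 <= ab.2 ->
    ab.2 <= T -> [/\ ab.1 <= m, m <= ab.2, w (ab.1, m) <= w ab / 2 &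
      w (m, ab.2) <= w ab / 2].
  move=> [a b] /=.
  have [Sa|nSa] := pselect (S <= a); last by exists a.
  have [ab|nab] := pselect (a <= b); last by exists a.
  have [bT|nbT] := pselect (b <= T); last by exists a.
  by have [m mP] := control_midpoint cw Sa ab bT; exists m.
pose Y n := bisect_sum (fun a b => mid (a, b)) n S T.
have mP a b : S <= a -> a <= b -> b <= T ->
  [/\ a <= mid (a, b), mid (a, b) <= b, w (a, mid (a, b)) <= w (a, b) / 2 &
      w (mid (a, b), b) <= w (a, b) / 2] by move=> *; exact: (midP (a, b)).
have Yc t : S <= t -> t <= T -> cvgn (Y ^~ t).
  move=> St tT; apply: (@cvg_geometric_increments _ _ (C * w (S, T) `^ theta) r).
  - by rewrite mulr_ge0// powR_ge0.
  - by rewrite r0 r1.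
  - by move=> n; exact: bisect_sum_increment.
pose y t := limn (Y ^~ t).
exists (fun st => y st.2 - y st.1); split => /=.
  by move=> s u t _ _ _ _; rewrite addrC addrA subrK.
exists (K * w (S, T) `^ eta); first by rewrite mulr_ge0// powR_ge0.
move=> s t Ss st tT.
have c1 : (fun n => `|Y n t - Y n s - Xi (s, t)|) @ \oo --> `|y t - y s - Xi (s, t)|.
  apply: cvg_norm; apply: cvgB; last exact: cvg_cst.
  by apply: cvgB; apply: Yc => //; [exact: le_trans st|exact: le_trans tT].
have c2 : (fun n => K * w (s, t) `^ theta' * w (S, T) `^ eta +
    C * w (S, T) `^ theta * r ^+ n) @ \oo --> K * w (s, t) `^ theta' * w (S, T) `^ eta + 0.
  apply: cvgD; first exact: cvg_cst.
  by apply: cvg_geometric; rewrite ger0_norm.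
rewrite mulrAC -[leRHS]addr0.
apply: (ler_cvg_to c1 c2); near=> n.
exact: bisect_sum_close.
Unshelve. all: by end_near. Qed.

End AdditiveSewing.

(** Bisection improves the constant of the bound [C * w `^ theta] by the factor
    [2 * 2^-1 `^ theta < 1], and can be repeated for ever. *)
Lemma additive_small_eq0 (S T : R) (w : R * R -> R) (W : normedModType R) (D : R * R -> W)
  (C theta : R) : is_control S T w -> 0 <= C -> 1 < theta ->
  (forall s u t, S <= s -> s <= u -> u <= t -> t <= T -> D (s, t) = D (s, u) + D (u, t)) ->
  (forall st, simplex S T st -> `|D st| <= C * w st `^ theta) ->
  forall st, simplex S T st -> D st = 0.
Proof.
move=> cw C0 th1 Dadd Dsmall.
pose r : R := 2 * 2^-1 `^ theta.
have r0 : 0 <= r by rewrite mulr_ge0// powR_ge0.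
have r1 : r < 1 by exact: double_half_powR_lt1.
have th0 : 0 <= theta by rewrite ltW// (lt_trans ltr01).
have Dn n s t : simplex S T (s, t) -> `|D (s, t)| <= C * r ^+ n * w (s, t) `^ theta.
  elim: n s t => [|n IH] s t st; first by rewrite expr0 mulr1; exact: Dsmall.
  have /simplexP[Ss st' tT] := st.
  have [m [sm mt wsm wmt]] := control_midpoint cw Ss st' tT.
  have sm' : simplex S T (s, m) by apply/simplexP; split => //; exact: le_trans tT.
  have mt' : simplex S T (m, t) by apply/simplexP; split => //; exact: le_trans sm.
  rewrite (Dadd s m t)// (le_trans (ler_normD _ _))//.
  have C' : 0 <= C * r ^+ n by rewrite mulr_ge0// exprn_ge0.
  have /andP[wsm0 _] := control_leST cw sm'.
  have /andP[wmt0 _] := control_leST cw mt'.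
  have h1 := le_trans (IH _ _ sm') (ler_wpM2l C' (powR_half_le th0 wsm0 wsm)).
  have h2 := le_trans (IH _ _ mt') (ler_wpM2l C' (powR_half_le th0 wmt0 wmt)).
  rewrite (le_trans (lerD h1 h2))// exprS /r.
  by rewrite le_eqVlt; apply/orP; left; apply/eqP; ring.
move=> [s t] st; apply/eqP; rewrite -normr_le0.
have c : (fun n => C * w (s, t) `^ theta * r ^+ n) @ \oo --> (0 : R).
  by apply: cvg_geometric; rewrite ger0_norm.
apply: (ler_cvg_to (cvg_cst _) c); near=> n.
by rewrite mulrAC; exact: Dn.
Unshelve. all: by end_near. Qed.

End Sewing.

(** * Products of tensors *)

Section Tensor.
Context {R : realType} {V : completeNormedModType R} (E : tensor_powers V).

(** [h] vanishes on the span of the pure tensors, which is dense, and the bound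
    makes it continuous. *)
Lemma tpow_linear_ext0 n (W : normedModType R) (h : tpow E n -> W) (c : R) :
  linear h -> (forall x, `|h x| <= c * `|x|) ->
  (forall v, h (pure E v) = 0) -> forall x, h x = 0.
Proof.
move=> hlin hbnd h0.
have hD x y : h (x + y) = h x + h y.
  by have := hlin 1 x y; rewrite !scale1r.
have h00 : h 0 = 0.
  by have := hD 0 0; rewrite addr0 => /eqP; rewrite -subr_eq0 opprD addNKr oppr_eq0 => /eqP.
have hZ a x : h (a *: x) = a *: h x.
  by have := hlin a x 0; rewrite addr0 h00 addr0.
have hB x y : h (x - y) = h x - h y.
  by rewrite hD -scaleN1r hZ scaleN1r.
have hspan (l : nat) (a : 'I_l -> R) (v : 'I_l -> n.-tuple V) :
    h (\sum_(i < l) a i *: pure E (v i)) = 0.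
  rewrite (big_morph h hD h00) big1// => i _.
  by rewrite hZ h0 scaler0.
move=> x; apply/eqP; rewrite -normr_eq0 eq_le normr_ge0 andbT.
apply/ler_addgt0Pr => e e0; rewrite add0r.
have c1 : 0 < `|c| + 1 by rewrite ltr_wpDl.
have eps0 : 0 < e / (`|c| + 1) by rewrite divr_gt0.
have [y [xy [l [a [v yE]]]]] : ball x (e / (`|c| + 1)) `&`
    [set x : tpow E n | exists (m : nat) (c : 'I_m -> R)
             (v : 'I_m -> n.-tuple V), x = \sum_(l < m) c l *: pure E (v l)] !=set0.
  apply: (pure_dense (n := n)).
    by exists x; exact: ballxx.
  exact: ball_open.
have -> : h x = h (x - y) by rewrite hB yE hspan subr0.
apply: (le_trans (hbnd _)).
move: xy; rewrite -ball_normE /= => xy.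
apply: (@le_trans _ _ ((`|c| + 1) * `|x - y|)).
  by rewrite ler_wpM2r// (le_trans (ler_norm c))// lerDl.
by rewrite mulrC -ler_pdivlMr// ltW.
Qed.

Lemma tpow_linear_ext n (W : normedModType R) (f g : tpow E n -> W) (c d : R) :
  linear f -> linear g -> (forall x, `|f x| <= c * `|x|) ->
  (forall x, `|g x| <= d * `|x|) ->
  (forall v, f (pure E v) = g (pure E v)) -> f =1 g.
Proof.
move=> fl gl fb gb fg x; apply/eqP; rewrite -subr_eq0; apply/eqP.
apply: (@tpow_linear_ext0 n W (fun x => f x - g x) (c + d)).
- move=> a u v; rewrite fl gl scalerBr; rewrite opprD !addrA; congr (_ + _).
  by rewrite addrAC.
- by move=> u; rewrite (le_trans (ler_normB _ _))// mulrDl lerD.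
- by move=> v; rewrite fg subrr.
Qed.

(** The product [tmul] read in degree [n], and [0] when the degrees do not add up
    to [n].  Making the target degree a parameter hides the casts along degree
    equalities, and sums over all pairs of degrees replace convolutions. *)
Definition gmul n j l (x : tpow E j) (y : tpow E l) : tpow E n :=
  match ((j + l)%N =P n) with
  | ReflectT e => ecast m (tpow E m) e (tmul x y)
  | ReflectF _ => 0
  end.

Lemma gmul_ecast n j l (e : (j + l)%N = n) (x : tpow E j) (y : tpow E l) :
  gmul n x y = ecast m (tpow E m) e (tmul x y).
Proof. by rewrite /gmul; case: eqP => // e'; rewrite (eq_irrelevance e e'). Qed.

Lemma gmulE j l (x : tpow E j) (y : tpow E l) : gmul (j + l) x y = tmul x y.
Proof. by rewrite (gmul_ecast erefl). Qed.

Lemma gmul0 n j l (x : tpow E j) (y : tpow E l) :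
  (j + l)%N != n -> gmul n x y = 0.
Proof. by rewrite /gmul; case: eqP. Qed.

Lemma gmul_linearl n j l (y : tpow E l) : linear (fun x : tpow E j => gmul n x y).
Proof.
move=> a x x'; have [e|ne] := eqVneq (j + l)%N n; last by rewrite !gmul0// scaler0 addr0.
by subst n; rewrite !gmulE tmul_linearl.
Qed.

Lemma gmul_linearr n j l (x : tpow E j) : linear (fun y : tpow E l => gmul n x y).
Proof.
move=> a y y'; have [e|ne] := eqVneq (j + l)%N n; last by rewrite !gmul0// scaler0 addr0.
by subst n; rewrite !gmulE tmul_linearr.
Qed.

Lemma gmulDl n j l (x x' : tpow E j) (y : tpow E l) :
  gmul n (x + x') y = gmul n x y + gmul n x' y.
Proof. by have := gmul_linearl n y 1 x x'; rewrite !scale1r. Qed.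

Lemma gmulDr n j l (x : tpow E j) (y y' : tpow E l) :
  gmul n x (y + y') = gmul n x y + gmul n x y'.
Proof. by have := gmul_linearr n x 1 y y'; rewrite !scale1r. Qed.

Lemma gmul0l n j l (y : tpow E l) : gmul n (0 : tpow E j) y = 0.
Proof. by apply/eqP; rewrite -(inj_eq (addrI (gmul n (0 : tpow E j) y))) -gmulDl !addr0. Qed.

Lemma gmul0r n j l (x : tpow E j) : gmul n x (0 : tpow E l) = 0.
Proof. by apply/eqP; rewrite -(inj_eq (addrI (gmul n x (0 : tpow E l)))) -gmulDr !addr0. Qed.

Lemma gmulBl n j l (x x' : tpow E j) (y : tpow E l) :
  gmul n (x - x') y = gmul n x y - gmul n x' y.
Proof. by apply/eqP; rewrite eq_sym subr_eq -gmulDl subrK. Qed.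

Lemma gmulBr n j l (x : tpow E j) (y y' : tpow E l) :
  gmul n x (y - y') = gmul n x y - gmul n x y'.
Proof. by apply/eqP; rewrite eq_sym subr_eq -gmulDr subrK. Qed.

Lemma gmul_suml n j l (I : Type) (r : seq I) (P : pred I)
    (F : I -> tpow E j) (y : tpow E l) :
  gmul n (\sum_(i <- r | P i) F i) y = \sum_(i <- r | P i) gmul n (F i) y.
Proof.
by apply: (big_morph (fun x => gmul n x y)) => [x x'|]; rewrite ?gmulDl ?gmul0l.
Qed.

Lemma gmul_sumr n j l (I : Type) (r : seq I) (P : pred I)
    (x : tpow E j) (F : I -> tpow E l) :
  gmul n x (\sum_(i <- r | P i) F i) = \sum_(i <- r | P i) gmul n x (F i).
Proof.
by apply: (big_morph (fun y => gmul n x y)) => [y y'|]; rewrite ?gmulDr ?gmul0r.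
Qed.

Lemma norm_gmul n j l (x : tpow E j) (y : tpow E l) : `|gmul n x y| <= `|x| * `|y|.
Proof.
have [e|ne] := eqVneq (j + l)%N n; last by rewrite gmul0// normr0 mulr_ge0.
by subst n; rewrite gmulE norm_tmul.
Qed.

Lemma gmul_pure n j l (e : (j + l)%N = n) (v : j.-tuple V) (u : l.-tuple V) :
  gmul n (pure E v) (pure E u) = pure E (tcast e [tuple of v ++ u]).
Proof. by subst n; rewrite gmulE tmul_pure tcast_id. Qed.

(** Both sides are linear and bounded in each argument and agree on pure tensors,
    where the product is concatenation. *)
Lemma gmul_assoc_eq n j l m (x : tpow E j) (y : tpow E l) (z : tpow E m) :
  (j + l + m)%N = n ->
  gmul n (gmul (j + l) x y) z = gmul n x (gmul (l + m) y z).
Proof.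
move=> e; move: x.
apply: (tpow_linear_ext (c := `|y| * `|z|) (d := `|y| * `|z|)).
- by move=> a x x'; rewrite gmul_linearl gmul_linearl.
- by move=> a x x'; rewrite gmul_linearl.
- move=> x; rewrite (le_trans (norm_gmul _ _ _))//.
  by rewrite [_ * `|x|]mulrC mulrA ler_wpM2r// norm_gmul.
- move=> x; rewrite (le_trans (norm_gmul _ _ _))//.
  by rewrite [_ * `|x|]mulrC ler_wpM2l// norm_gmul.
move=> v; move: y.
apply: (tpow_linear_ext (c := `|pure E v| * `|z|) (d := `|pure E v| * `|z|)).
- by move=> a x x'; rewrite gmul_linearr gmul_linearl.
- by move=> a x x'; rewrite gmul_linearl gmul_linearr.
- move=> x; rewrite (le_trans (norm_gmul _ _ _))//.
  by rewrite mulrAC ler_wpM2r// norm_gmul.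
- move=> x; rewrite (le_trans (norm_gmul _ _ _))//.
  by rewrite -mulrA [_ * `|x|]mulrC ler_wpM2l// norm_gmul.
move=> u; move: z.
apply: (tpow_linear_ext (c := `|pure E v| * `|pure E u|)
                        (d := `|pure E v| * `|pure E u|)).
- by move=> a x x'; rewrite gmul_linearr.
- by move=> a x x'; rewrite gmul_linearr gmul_linearr.
- move=> x; rewrite (le_trans (norm_gmul _ _ _))//.
  by rewrite ler_wpM2r// norm_gmul.
- move=> x; rewrite (le_trans (norm_gmul _ _ _))//.
  by rewrite -mulrA ler_wpM2l// norm_gmul.
move=> t; have e' : (j + (l + m))%N = n by rewrite addnA.
rewrite !gmulE !tmul_pure (gmul_pure e) (gmul_pure e').
by congr (pure E _); apply: val_inj; rewrite /= !val_tcast /= catA.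
Qed.

Lemma gmul_unitl n (x : tpow E n) : gmul n (pure E [tuple]) x = x.
Proof.
move: x; apply: (tpow_linear_ext (c := 1) (d := 1)).
- exact: gmul_linearr.
- by move=> a x y.
- by move=> x; rewrite (le_trans (norm_gmul _ _ _))// norm_pure0.
- by move=> x; rewrite mul1r.
move=> v; rewrite (gmul_pure (add0n n)); congr pure; apply/val_inj.
by rewrite /= val_tcast.
Qed.

Lemma gmul_unitr n (x : tpow E n) : gmul n x (pure E [tuple]) = x.
Proof.
move: x; apply: (tpow_linear_ext (c := 1) (d := 1)).
- exact: gmul_linearl.
- by move=> a x y.
- by move=> x; rewrite (le_trans (norm_gmul _ _ _))// norm_pure0 mulr1 mul1r.
- by move=> x; rewrite mul1r.
move=> v; rewrite (gmul_pure (addn0 n)); congr pure; apply/val_inj.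
by rewrite /= val_tcast /= cats0.
Qed.

End Tensor.

(** * The truncated tensor algebra *)

Section TruncAlg.
Context {R : realType} {V : completeNormedModType R} (E : tensor_powers V).
Variable k : nat.
Implicit Types (a b c d : trunc_alg E k) (i : 'I_k.+1).

(** Only [m = j + l] contributes on the left and [m = l + r] on the right. *)
Lemma sum_gmul_assoc i j l r (x : tpow E j) (y : tpow E l) (z : tpow E r) :
  \sum_(m < k.+1) gmul i (gmul m x y) z = \sum_(m < k.+1) gmul i x (gmul m y z).
Proof.
have [e|ne] := eqVneq (j + l + r)%N i; last first.
  rewrite !big1// => m _.
    have [em|nm] := eqVneq (l + r)%N m; last by rewrite (gmul0 _ _ nm) gmul0r.
    by rewrite gmul0// -em addnA.
  have [em|nm] := eqVneq (j + l)%N m; last by rewrite (gmul0 _ _ nm) gmul0l.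
  by rewrite gmul0// -em.
have jl : (j + l < k.+1)%N by rewrite (leq_ltn_trans _ (ltn_ord i))// -e leq_addr.
have lr : (l + r < k.+1)%N.
  by rewrite (leq_ltn_trans _ (ltn_ord i))// -e -addnA leq_addl.
rewrite [LHS](bigD1 (Ordinal jl))//= [RHS](bigD1 (Ordinal lr))//=.
rewrite [X in _ + X = _]big1 ?[X in _ = _ + X]big1 ?addr0.
- exact: gmul_assoc_eq.
- move=> m; rewrite -val_eqE /= => nm; rewrite (gmul0 _ _ (n := m)) ?gmul0r//.
  by rewrite eq_sym.
- move=> m; rewrite -val_eqE /= => nm; rewrite (gmul0 _ _ (n := m)) ?gmul0l//.
  by rewrite eq_sym.
Qed.

Lemma trunc_mulE a b i :
  trunc_mul a b i = \sum_(j < k.+1) \sum_(l < k.+1) gmul i (a j) (b l).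
Proof.
rewrite [RHS](bigID (fun j : 'I_k.+1 => (j < i.+1)%N))/=.
rewrite [X in _ + X]big1 ?addr0; last first.
  move=> j; rewrite -leqNgt => ij; rewrite big1// => l _; rewrite gmul0//.
  by rewrite gtn_eqF// (leq_trans ij)// leq_addr.
rewrite (big_ord_narrow (ltn_ord i)); apply: eq_bigr => j _.
rewrite (bigD1 (widen_ord (ltn_ord i) (sub_ord j)))//= big1 ?addr0.
  by rewrite (gmul_ecast (subnKC (leq_ord j))).
move=> l; rewrite -val_eqE /= => nl; rewrite gmul0//=.
apply: contra nl => /eqP e.
have : (j + l - j = i - j)%N by rewrite e.
by rewrite addKn => ->.
Qed.

Lemma trunc_mulA a b c : trunc_mul (trunc_mul a b) c = trunc_mul a (trunc_mul b c).
Proof.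
apply: functional_extensionality_dep => i; rewrite !trunc_mulE.
transitivity (\sum_(j < k.+1) \sum_(l < k.+1) \sum_(r < k.+1) \sum_(m < k.+1)
    gmul i (gmul m (a j) (b l)) (c r)).
  under eq_bigr => m _ do under eq_bigr => r _ do rewrite trunc_mulE gmul_suml.
  under eq_bigr => m _ do under eq_bigr => r _ do
    under eq_bigr => j _ do rewrite gmul_suml.
  under eq_bigr => m _ do rewrite exchange_big.
  rewrite exchange_big; apply: eq_bigr => j _.
  under eq_bigr => m _ do rewrite exchange_big.
  rewrite exchange_big; apply: eq_bigr => l _.
  by rewrite exchange_big.
apply: eq_bigr => j _.
under [RHS]eq_bigr => m _ do rewrite trunc_mulE gmul_sumr.
under [RHS]eq_bigr => m _ do under eq_bigr => l _ do rewrite gmul_sumr.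
rewrite [RHS]exchange_big; apply: eq_bigr => l _.
rewrite [RHS]exchange_big; apply: eq_bigr => r _.
exact: sum_gmul_assoc.
Qed.

(** The part of the level-[i] product that involves both factors in positive
    degree: all of it except the contributions of the two units. *)
Definition cross a b i : tpow E i :=
  \sum_(j < k.+1 | j != ord0) \sum_(l < k.+1 | l != ord0) gmul i (a j) (b l).

Lemma trunc_mul_unital a b i : a ord0 = pure E [tuple] -> b ord0 = pure E [tuple] ->
  i != ord0 -> trunc_mul a b i = a i + b i + cross a b i.
Proof.
move=> a0 b0 i0; rewrite trunc_mulE (bigD1 ord0)//=.
rewrite (bigD1 i)//= a0 gmul_unitl [X in _ + X + _]big1 ?addr0; last first.
  by move=> j ji; rewrite gmul0// add0n.
rewrite [a i + b i]addrC -addrA; congr (_ + _).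
under eq_bigr => j _ do rewrite (bigD1 ord0)//= b0.
rewrite big_split/= (bigD1 i)//= gmul_unitr big1 ?addr0//.
by move=> j /andP[_ ji]; rewrite gmul0// addn0.
Qed.

(** Two positive degrees that add up to [i] are both smaller than [i]. *)
Lemma eq_cross a b c d i :
  (forall j : 'I_k.+1, (0 < j < i)%N -> a j = c j) ->
  (forall j : 'I_k.+1, (0 < j < i)%N -> b j = d j) ->
  cross a b i = cross c d i.
Proof.
move=> ac bd; apply: eq_bigr => j j0; apply: eq_bigr => l l0.
have [e|ne] := eqVneq (j + l)%N i; last by rewrite !gmul0.
rewrite -val_eqE /= -lt0n in j0; rewrite -val_eqE /= -lt0n in l0.
have ji : (j < i)%N by rewrite -e -addn1 leq_add2l.
have li : (l < i)%N by rewrite -e -add1n leq_add2r.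
by rewrite ac ?j0// bd ?l0.
Qed.

Lemma crossDl a b c i :
  cross (fun j => a j + b j) c i = cross a c i + cross b c i.
Proof.
rewrite /cross -big_split/=; apply: eq_bigr => j _.
by rewrite -big_split/=; apply: eq_bigr => l _; rewrite gmulDl.
Qed.

Lemma crossDr a b c i :
  cross a (fun j => b j + c j) i = cross a b i + cross a c i.
Proof.
rewrite /cross -big_split/=; apply: eq_bigr => j _.
by rewrite -big_split/=; apply: eq_bigr => l _; rewrite gmulDr.
Qed.

Lemma norm_cross a b i (A B : R) : 0 <= A -> 0 <= B ->
  (forall j : 'I_k.+1, (0 < j)%N -> `|a j| <= A) ->
  (forall j : 'I_k.+1, (0 < j)%N -> `|b j| <= B) ->
  `|cross a b i| <= k.+1%:R ^+ 2 * (A * B).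
Proof.
move=> A0 B0 aA bB.
rewrite /cross pair_big/= (le_trans (ler_norm_sum _ _ _))//.
have -> : k.+1%:R ^+ 2 * (A * B) = \sum_(x : 'I_k.+1 * 'I_k.+1) A * B.
  by rewrite sumr_const card_prod card_ord -[RHS]mulr_natl natrM expr2.
rewrite big_mkcond/=; apply: ler_sum => -[j l] _ /=.
case: ifPn => [/andP[j0 l0]|_]; last exact: mulr_ge0.
by rewrite (le_trans (norm_gmul _ _ _))// ler_pM ?aA ?bB// lt0n.
Qed.

Lemma trunc_mul_ord0 a b : a ord0 = pure E [tuple] -> b ord0 = pure E [tuple] ->
  trunc_mul a b ord0 = pure E [tuple].
Proof.
move=> a0 b0; rewrite trunc_mulE (bigD1 ord0)//= (bigD1 ord0)//= a0 b0.
rewrite (gmul_unitl (n := 0)) [X in _ + X + _]big1 ?addr0; last first.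
  by move=> j; rewrite -val_eqE /= => j0; rewrite gmul0.
rewrite big1 ?addr0// => j; rewrite -val_eqE /= => j0.
by rewrite big1// => l _; rewrite gmul0// addn_eq0 negb_and j0.
Qed.

(** For unital factors level [i] of the product is additive in the two levels [i];
    everything else in it is determined by the lower levels. *)
Lemma trunc_mul_low a b c d i :
  a ord0 = pure E [tuple] -> b ord0 = pure E [tuple] ->
  c ord0 = pure E [tuple] -> d ord0 = pure E [tuple] ->
  (forall j : 'I_k.+1, (j < i)%N -> a j = c j) ->
  (forall j : 'I_k.+1, (j < i)%N -> b j = d j) ->
  trunc_mul a b i = trunc_mul c d i + (a i - c i) + (b i - d i).
Proof.
move=> a0 b0 c0 d0 ac bd; have [->|i0] := eqVneq i ord0.
  by rewrite !trunc_mul_ord0// a0 b0 c0 d0 subrr !addr0.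
rewrite !trunc_mul_unital// (@eq_cross a b c d); last 2 first.
- by move=> j /andP[_]; exact: ac.
- by move=> j /andP[_]; exact: bd.
by rewrite -[RHS]addrA [a i - _ + _]addrACA -opprD [c i + d i + _]addrC
  -[RHS]addrA subrKC addrC.
Qed.

Lemma trunc_mul_lip a b c d i (B D : R) : 0 <= B -> 0 <= D ->
  (forall j, `|a j| <= B) -> (forall j, `|b j| <= B) ->
  (forall j, `|c j| <= B) -> (forall j, `|d j| <= B) ->
  (forall j, `|a j - c j| <= D) -> (forall j, `|b j - d j| <= D) ->
  `|trunc_mul a b i - trunc_mul c d i| <= k.+1%:R ^+ 2 * (2 * B * D).
Proof.
move=> B0 D0 aB bB cB dB ac bd; rewrite !trunc_mulE !pair_big/=.
rewrite -sumrB (le_trans (ler_norm_sum _ _ _))//.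
have -> : k.+1%:R ^+ 2 * (2 * B * D) = \sum_(x : 'I_k.+1 * 'I_k.+1) 2 * B * D.
  by rewrite sumr_const card_prod card_ord -[RHS]mulr_natl natrM expr2.
apply: ler_sum => -[j l] _ /=.
have -> : gmul i (a j) (b l) - gmul i (c j) (d l) =
    gmul i (a j - c j) (b l) + gmul i (c j) (b l - d l).
  by rewrite gmulBl gmulBr addrA subrK.
rewrite (le_trans (ler_normD _ _))// -mulrA mulr_natl mulr2n lerD//.
  by rewrite (le_trans (norm_gmul _ _ _))// mulrC ler_pM.
by rewrite (le_trans (norm_gmul _ _ _))// ler_pM.
Qed.

Lemma trunc_one_pos (j : 'I_k.+1) : (0 < j)%N -> @trunc_one R V E k j = 0.
Proof. by case: j => -[]. Qed.

Lemma trunc_mul1r b : trunc_mul (@trunc_one R V E k) b = b.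
Proof.
apply: functional_extensionality_dep => i; rewrite trunc_mulE (bigD1 ord0)//=.
rewrite (bigD1 i)//= gmul_unitl.
rewrite [X in _ + X + _]big1 ?addr0; last by move=> j ji; rewrite gmul0// add0n.
rewrite big1 ?addr0// => -[[//|j] ?] _; rewrite big1// => l _; exact: gmul0l.
Qed.

Lemma trunc_mulr1 b : trunc_mul b (@trunc_one R V E k) = b.
Proof.
apply: functional_extensionality_dep => i; rewrite trunc_mulE exchange_big (bigD1 ord0)//=.
rewrite (bigD1 i)//= gmul_unitr.
rewrite [X in _ + X + _]big1 ?addr0; last by move=> j ji; rewrite gmul0// addn0.
rewrite big1 ?addr0// => -[[//|j] ?] _; rewrite big1// => l _; exact: gmul0r.
Qed.

End TruncAlg.

(** * Positivity of the normalising factors *)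

Section Constants.
Context {R : realType}.
Let mu := @lebesgue_measure R.

(** The inequality [x <= expR x] at [x = t / (2 * a)], raised to the power [a]. *)
Let powR_le_expR (a t : R) : 0 < a -> 0 <= t ->
  t `^ a <= (a *+ 2) `^ a * expR (t / 2).
Proof.
move=> a0 t0; have a20 : 0 < a *+ 2 by rewrite mulrn_wgt0.
have -> : t = (a *+ 2) * (t / (a *+ 2)).
  by rewrite mulrCA divff ?mulr1// gt_eqF.
set x := t / (a *+ 2); have x0 : 0 <= x by rewrite divr_ge0// ltW.
rewrite powRM ?(ltW a20)//.
rewrite ler_wpM2l ?powR_ge0//.
have -> : a *+ 2 * x / 2 = x * a by field.
rewrite expRM ler_powR_base ?(ltW a0)//.
by rewrite (le_trans _ (expR_ge1Dx x))// lerDr.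
Qed.

Let Gamma_integrand_le (a t : R) : 0 < a -> 0 <= t ->
  t `^ a * expR (- t) <= (a *+ 2) `^ a *+ 2 * (2^-1 * expR (- 2^-1 * t)).
Proof.
move=> a0 t0.
have := ler_wpM2r (expR_ge0 (- t)) (powR_le_expR a0 t0).
rewrite -mulrA -expRD.
have -> : t / 2 - t = - 2^-1 * t by field.
by rewrite -[_ `^ a *+ 2]mulr_natl mulrACA mulfV ?mul1r.
Qed.

(** The integral is positive because it is at least [expR (- 2)] between 1 and 2.
    It is also finite, being dominated by an exponential density; finiteness matters
    since a divergent integral would be turned into [0] by [fine]. *)
Lemma rfact_gt0 (a : R) : 0 < a -> 0 < rfact a.
Proof.
move=> a0; rewrite /rfact /Gamma addrK /Rintegral.
pose f t : R := t `^ a * expR (- t).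
have mf (D : set R) : measurable_fun D (EFin \o f).
  apply/measurable_EFinP; apply: measurable_funTS; apply: measurable_funM.
    exact: measurable_powR.
  by apply: measurableT_comp => //; exact: measurable_funN.
have f0 t : (0 <= (f t)%:E)%E by rewrite lee_fin mulr_ge0 ?powR_ge0 ?expR_ge0.
apply: fine_gt0; apply/andP; split.
  apply: (@lt_le_trans _ _ (\int[mu]_(t in `[1%R, 2%R]) (expR (- 2))%:E)%E).
    rewrite integral_cst//= lebesgue_measure_itv/= lte_fin ltr1n.
    by rewrite -EFinB -EFinM lte_fin mulr_gt0 ?expR_gt0// subr_gt0 ltr1n.
  apply: (@le_trans _ _ (\int[mu]_(t in `[1%R, 2%R]) (f t)%:E)%E).
    apply: ge0_le_integral => //=.
    - exact (mf _).
    - move=> t; rewrite in_itv/= => /andP[t1 t2]; rewrite lee_fin.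
      rewrite -[leLHS]mul1r ler_pM ?expR_ge0//.
        by rewrite -[leLHS](powRr0 t) ler_powR ?(ltW a0).
      by rewrite ler_expR lerN2.
  apply: ge0_subset_integral => //=; first exact (mf _).
  move=> t; rewrite /= !in_itv/= => /andP[t1 _]; rewrite andbT.
  exact: lt_le_trans t1.
pose c : R := (a *+ 2) `^ a *+ 2.
have half0 : 0 < 2^-1 :> R by rewrite invr_gt0.
have c0 : 0 <= c by rewrite mulrn_wge0// powR_ge0.
apply: (@le_lt_trans _ _
   (\int[mu]_(t in `]0%R, +oo[) (c%:E * (exponential_pdf 2^-1 t)%:E))%E).
  apply: ge0_le_integral => //=.
  - by move=> t _; exact: f0.
  - exact (mf _).
  - apply: measurable_funeM; apply/measurable_EFinP; apply: measurable_funTS.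
    exact: measurable_exponential_pdf.
  move=> t; rewrite in_itv/= andbT => t0.
  rewrite -EFinM lee_fin exponential_pdfE ?(ltW t0)//.
  exact (Gamma_integrand_le a0 (ltW t0)).
apply: (@le_lt_trans _ _
   (\int[mu]_(t in setT) (c%:E * (exponential_pdf 2^-1 t)%:E))%E).
  apply: ge0_subset_integral => //=.
    apply: measurable_funeM; apply/measurable_EFinP; apply: measurable_funTS.
    exact: measurable_exponential_pdf.
  by move=> t _; rewrite -EFinM lee_fin mulr_ge0// exponential_pdf_ge0// ltW.
rewrite integralZl//; last exact: integrable_exponential_pdf.
by rewrite integral_exponential_pdf// mule1 ltry.
Qed.

Lemma beta_const_gt0 (p : R) : 0 < p -> 0 < beta_const p.
Proof.
move=> p0; rewrite /beta_const mulr_gt0// ltr_pwDl//.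
set u := (X in limn X).
(* a divergent [limn] takes the default value 0 *)
have [cu|/dvgP ->//] := pselect (cvgn u).
by apply: limr_ge => //; near=> n; rewrite sumr_ge0// => i _; exact: powR_ge0.
Unshelve. all: by end_near. Qed.

End Constants.

(** * Functionals of finite p-variation *)

Section Functionals.
Context {R : realType} {V : completeNormedModType R} (E : tensor_powers V).
Variables (S T : R) (k : nat).
Implicit Types (X Y Z : R * R -> trunc_alg E k) (w : R * R -> R) (i j : 'I_k.+1).

Let pvar_den (p : R) i := beta_const p * rfact (i%:R / p).

Let pvar_den_gt0 p i : 1 <= p -> (0 < i)%N -> 0 < pvar_den p i.
Proof.
move=> p1 i0; have p0 : 0 < p by exact: lt_le_trans p1.
by rewrite mulr_gt0 ?beta_const_gt0// rfact_gt0// divr_gt0// ltr0n.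
Qed.

Lemma pvar_controlled_le p w w' (K K' : R) X : 1 <= p -> K <= K' -> 0 <= K ->
  (forall st, simplex S T st -> 0 <= w st <= w' st) ->
  pvar_controlled S T p w K X -> pvar_controlled S T p w' K' X.
Proof.
move=> p1 KK' K0 ww' hX i i0 st hst; apply: (le_trans (hX i i0 st hst)).
have p0 : 0 < p by exact: lt_le_trans p1.
have /andP[w0 wle] := ww' st hst.
rewrite ler_wpM2r ?invr_ge0 ?(ltW (pvar_den_gt0 p1 i0))//.
by rewrite ler_pM ?powR_ge0// ler_powR_base// divr_ge0// ltW.
Qed.

Lemma pvar_controlledD p w (K L : R) X Y Z :
  pvar_controlled S T p w K X -> pvar_controlled S T p w L Y ->
  (forall st i, simplex S T st -> (0 < i)%N -> `|Z st i| <= `|X st i| + `|Y st i|) ->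
  pvar_controlled S T p w (K + L) Z.
Proof.
move=> hX hY hZ i i0 st hst; rewrite (le_trans (hZ _ _ hst i0))//.
by rewrite !mulrDl lerD// ?hX ?hY.
Qed.

(** An error term of order [w `^ theta] with [theta >= 1] is of finite
    [p]-variation, because [i / p <= 1] for the levels [i <= k <= p]. *)
Lemma pvar_controlled_pow p w (C theta : R) Z :
  is_control S T w -> 1 <= p -> k%:R <= p -> 1 <= theta -> 0 <= C ->
  (forall st i, simplex S T st -> (0 < i)%N -> `|Z st i| <= C * w st `^ theta) ->
  exists2 K, 0 <= K & pvar_controlled S T p w K Z.
Proof.
move=> cw p1 kp th1 C0 hZ; have p0 : 0 < p by exact: lt_le_trans p1.
pose M i := C * w (S, T) `^ (theta - i%:R / p) * pvar_den p i.
have M0 i : (0 < i)%N -> 0 <= M i.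
  move=> i0; apply: mulr_ge0; first by rewrite mulr_ge0 ?powR_ge0.
  exact/ltW/pvar_den_gt0.
exists (\sum_(i < k.+1 | (0 < i)%N) M i); first by rewrite sumr_ge0.
move=> i i0 [s t] hst; rewrite (le_trans (hZ _ _ hst i0))//.
rewrite ler_pdivlMr; last exact: pvar_den_gt0.
have /andP[w0 wW] := control_leST cw hst.
apply: (@le_trans _ _ (M i * w (s, t) `^ (i%:R / p))); last first.
  rewrite ler_wpM2r ?powR_ge0// (bigD1 i)//= lerDl sumr_ge0// => j /andP[j0 _].
  exact: M0.
rewrite /M [leRHS]mulrAC ler_wpM2r ?(ltW (pvar_den_gt0 p1 i0))//.
rewrite -mulrA ler_wpM2l//.
have ip : i%:R / p <= theta.
  rewrite (le_trans _ th1)// ler_pdivrMr// mul1r (le_trans _ kp)// ler_nat.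
  by rewrite -ltnS.
by apply: ler_powR_exponent => //; rewrite divr_ge0// ltW.
Qed.

(** Every positive level is dominated by the rate of level 1, the slowest. *)
Lemma pvar_bound p w K X : is_control S T w -> 1 <= p -> 0 <= K ->
  pvar_controlled S T p w K X ->
  exists2 N, 0 <= N & forall st i, simplex S T st -> (0 < i)%N ->
    `|X st i| <= N * w st `^ p^-1.
Proof.
move=> cw p1 K0 hX; have p0 : 0 < p by exact: lt_le_trans p1.
pose M i := K / pvar_den p i * w (S, T) `^ (i%:R / p - p^-1).
have M0 i : (0 < i)%N -> 0 <= M i.
  by move=> i0; rewrite mulr_ge0 ?powR_ge0// divr_ge0// ltW// pvar_den_gt0.
exists (\sum_(i < k.+1 | (0 < i)%N) M i); first by rewrite sumr_ge0.
move=> [s t] i hst i0; rewrite (le_trans (hX i i0 _ hst))//.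
have /andP[w0 wW] := control_leST cw hst.
apply: (@le_trans _ _ (M i * w (s, t) `^ p^-1)); last first.
  rewrite ler_wpM2r ?powR_ge0// (bigD1 i)//= lerDl sumr_ge0// => j /andP[j0 _].
  exact: M0.
rewrite mulrAC /M -[leRHS]mulrA ler_wpM2l ?divr_ge0 ?(ltW (pvar_den_gt0 p1 i0))//.
apply: ler_powR_exponent => //; first by rewrite invr_ge0 ltW.
by rewrite ler_pdivlMr// mulVf ?gt_eqF// ler1n.
Qed.

(** Chen's identity up to level [m] only, the induction hypothesis of the
    level-by-level construction below. *)
Definition multiplicative_on X (m : nat) := forall s u t, S <= s -> s <= u -> u <= t ->
  t <= T -> forall i, (i <= m)%N -> trunc_mul (X (s, u)) (X (u, t)) i = X (s, t) i.

(** Once the levels below [i] agree, the difference at level [i] is additive, and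
    an additive map of order [w `^ theta] with [theta > 1] vanishes. *)
Lemma multiplicative_unique w (C theta : R) Y Y' : is_control S T w -> 0 <= C -> 1 < theta ->
  unital S T Y -> unital S T Y' -> multiplicative_on Y k -> multiplicative_on Y' k ->
  (forall st i, simplex S T st -> (0 < i)%N -> `|Y st i - Y' st i| <= C * w st `^ theta) ->
  forall st, simplex S T st -> Y st = Y' st.
Proof.
move=> cw C0 th1 uY uY' mY mY' hYY'.
suff H n : forall i, (i <= n)%N -> forall st, simplex S T st -> Y st i = Y' st i.
  by move=> st hst; apply: functional_extensionality_dep => i; exact: (H i).
elim: n => [|n IH] i.
  by rewrite leqn0 => /eqP i0 st hst; have -> : i = ord0; [exact: val_inj|rewrite uY// uY'].
rewrite leq_eqVlt => /predU1P[i_n|]; last by rewrite ltnS; exact: IH.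
move=> st hst; apply/eqP; rewrite -subr_eq0; apply/eqP; move: st hst.
apply: (additive_small_eq0 (w := w) (C := C) (theta := theta)) => //; last first.
  by move=> st hst; apply: hYY' => //; rewrite i_n.
move=> s u t Ss su ut tT.
have hsu : simplex S T (s, u) by apply/simplexP; split => //; exact: le_trans tT.
have hut : simplex S T (u, t) by apply/simplexP; split => //; exact: le_trans su.
have ik : (i <= k)%N by rewrite -ltnS.
rewrite -(mY s u t)// -(mY' s u t)//.
rewrite (@trunc_mul_low _ _ _ _ _ _ (Y' (s, u)) (Y' (u, t)))//.
- by rewrite [LHS]addrC !addrA addNr add0r.
- exact: uY.
- exact: uY.
- exact: uY'.
- exact: uY'.
- by move=> j; rewrite i_n ltnS => jn; exact: IH.
- by move=> j; rewrite i_n ltnS => jn; exact: IH.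
Qed.

End Functionals.

Section Continuity.
Context {R : realType} {V : completeNormedModType R} (E : tensor_powers V).
Variables (S T : R) (k : nat).
Implicit Types (X Y Z : R * R -> trunc_alg E k) (w : R * R -> R) (i j : 'I_k.+1).

(** Both endpoints tend to the same point of the diagonal, where [w] vanishes. *)
Lemma control_pow_cvg0 w (q : R) (f g : R * R -> R) (x : R * R) :
  is_control S T w -> 0 < q -> simplex S T x ->
  {for x, continuous f} -> {for x, continuous g} -> f x = g x ->
  (forall st, simplex S T st -> simplex S T (f st, g st)) ->
  (fun st => w (f st, g st) `^ q) @ within (simplex S T) (nbhs x) --> 0.
Proof.
move=> cw q0 hx cf cg fg hfg.
have w0 : (fun st => w (f st, g st)) @ within (simplex S T) (nbhs x) --> 0.
  have hfgx := hfg _ hx.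
  have <- : w (f x, g x) = 0.
    case: (cw) => _ _ wd _; rewrite -fg wd//.
    by have /simplexP[-> _] := hfgx; rewrite fg.
  case: cw => /subspace_continuousP /(_ _ hfgx) wc _ _ _.
  apply: (cvg_comp (fun st => (f st, g st)) w _ wc) => P /= hP.
  have hfgc : (fun st => (f st, g st)) @ x --> (f x, g x) by exact: (cvg_pair cf cg).
  have := hfgc _ hP; rewrite /within/= /nbhs/=.
  by apply: filterS => st h hst; apply: h; exact: hfg.
apply/cvgr0Pnorm_le => e e0.
have e'0 : 0 < e `^ q^-1 by rewrite powR_gt0.
move/cvgr0Pnorm_le : w0 => /(_ _ e'0) w0.
near=> st.
have hst : simplex S T st by near: st; exact: withinT.
have wst : 0 <= w (f st, g st) by have [_ + _ _] := cw; apply; exact: hfg.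
have : `|w (f st, g st)| <= e `^ q^-1.
  by near: st; exact: w0.
rewrite !ger0_norm ?powR_ge0// => h.
rewrite (le_trans (ler_powR_base (ltW q0) wst h))//.
by rewrite -powRrM mulVf ?gt_eqF// powRr1// ltW.
Unshelve. all: by end_near. Qed.

Lemma norm_unital_le (N : R) X : 0 <= N -> unital S T X ->
  (forall st i, simplex S T st -> (0 < i)%N -> `|X st i| <= N) ->
  forall st i, simplex S T st -> `|X st i| <= 1 + N.
Proof.
move=> N0 uX hX st i hst; have [i0|] := posnP i.
  have -> : i = ord0 by exact: val_inj.
  by rewrite uX// norm_pure0 lerDl.
by move=> i0; rewrite (le_trans (hX _ _ hst i0))// lerDr.
Qed.

(** By Chen's identity, moving one endpoint multiplies [Y] by a factor that
    differs from the unit by [O(w `^ p^-1)].  Two points of the simplex are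
    compared through the enclosing interval from the smaller left endpoint to
    the larger right endpoint, so that neither order of the endpoints nor the
    diagonal is a special case. *)
Lemma multiplicative_continuous p w K Y : is_control S T w -> 1 <= p -> 0 <= K ->
  unital S T Y -> multiplicative_on S T Y k -> pvar_controlled S T p w K Y ->
  {within simplex S T, continuous Y}.
Proof.
move=> cw p1 K0 uY mY hY.
have p0 : 0 < p by exact: lt_le_trans p1.
have [N N0 hN] := pvar_bound cw p1 K0 hY.
set W := w (S, T); pose B := 1 + N * W `^ p^-1.
have B0 : 0 <= B by rewrite addr_ge0// mulr_ge0// powR_ge0.
have YB st i : simplex S T st -> `|Y st i| <= B.
  apply: norm_unital_le; rewrite ?mulr_ge0 ?powR_ge0// => -[s t] j hst j0.
  rewrite (le_trans (hN _ _ hst j0))// ler_wpM2l//.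
  have /andP[? ?] := control_leST cw hst.
  by rewrite ler_powR_base// invr_ge0 ltW.
pose q := p^-1; have q0 : 0 < q by rewrite invr_gt0.
have one_le i : `|@trunc_one R V E k i| <= B.
  have [i0|i0] := posnP i.
    have -> : i = ord0 by exact: val_inj.
    by rewrite norm_pure0 lerDl mulr_ge0// powR_ge0.
  by rewrite trunc_one_pos// normr0.
have Y1 s t i : simplex S T (s, t) -> `|Y (s, t) i - trunc_one E i| <= N * w (s, t) `^ q.
  move=> hst; have [i0|i0] := posnP i.
    have -> : i = ord0 by exact: val_inj.
    by rewrite uY// subrr normr0 mulr_ge0// powR_ge0.
  by rewrite trunc_one_pos// subr0 hN.
pose L := k.+1%:R ^+ 2 * (2 * B * N).
have YYE s u t i : simplex S T (s, u) -> simplex S T (u, t) ->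
    Y (s, t) i = trunc_mul (Y (s, u)) (Y (u, t)) i.
  move=> /simplexP[? ? ?] /simplexP[? ? ?]; rewrite mY//.
  by rewrite -ltnS.
have left_lip s u t i : simplex S T (s, u) -> simplex S T (u, t) ->
    `|Y (s, t) i - Y (u, t) i| <= L * w (s, u) `^ q.
  move=> su ut; rewrite (YYE s u)// -{2}(trunc_mul1r (Y (u, t))).
  rewrite /L -mulrA -[_ * N * _]mulrA; apply: trunc_mul_lip => //.
  - by rewrite mulr_ge0// powR_ge0.
  - by move=> j; exact: YB.
  - by move=> j; exact: YB.
  - by move=> j; exact: YB.
  - by move=> j; exact: Y1.
  - by move=> j; rewrite subrr normr0 mulr_ge0// powR_ge0.
have right_lip s u t i : simplex S T (s, u) -> simplex S T (u, t) ->
    `|Y (s, t) i - Y (s, u) i| <= L * w (u, t) `^ q.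
  move=> su ut; rewrite (YYE s u)// -{2}(trunc_mulr1 (Y (s, u))).
  rewrite /L -mulrA -[_ * N * _]mulrA; apply: trunc_mul_lip => //.
  - by rewrite mulr_ge0// powR_ge0.
  - by move=> j; exact: YB.
  - by move=> j; exact: YB.
  - by move=> j; exact: YB.
  - by move=> j; rewrite subrr normr0 mulr_ge0// powR_ge0.
  - by move=> j; exact: Y1.
apply/subspace_continuousP => -[s0 t0] h0.
apply/cvg_sup => i U [/= _ [[P oP <- /= PY]]] /filterS; apply.
suff cvgi : (fun st => Y st i) @ within (simplex S T) (nbhs (s0, t0)) --> Y (s0, t0) i.
  by apply: cvgi; exact: open_nbhs_nbhs.
have /simplexP[Ss0 s0t0 t0T] := h0.
pose e1 (st : R * R) := w (Num.min st.1 s0, st.1) `^ q.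
pose e2 (st : R * R) := w (Num.min st.1 s0, s0) `^ q.
pose e3 (st : R * R) := w (st.2, Num.max st.2 t0) `^ q.
pose e4 (st : R * R) := w (t0, Num.max st.2 t0) `^ q.
have near_le st : simplex S T st ->
    `|Y st i - Y (s0, t0) i| <= L * (e1 st + e3 st + (e2 st + e4 st)).
  case: st => s t hst; have /simplexP[Ss st tT] := hst.
  set m := Num.min s s0; set M := Num.max t t0.
  have mlow : S <= m by rewrite le_min Ss.
  have Mupp : M <= T by rewrite ge_max tT.
  have ms : m <= s by rewrite ge_min lexx.
  have ms0 : m <= s0 by rewrite ge_min lexx orbT.
  have tM : t <= M by rewrite le_max lexx.
  have t0M : t0 <= M by rewrite le_max lexx orbT.
  have H s1 t1 : simplex S T (s1, t1) -> m <= s1 -> t1 <= M ->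
      `|Y (m, M) i - Y (s1, t1) i| <= L * (w (m, s1) `^ q + w (t1, M) `^ q).
    move=> /simplexP[Ss1 s1t1 t1T] ms1 t1M.
    rewrite (le_trans (ler_distD (Y (m, t1) i) _ _))// mulrDr [leRHS]addrC lerD//.
      apply: right_lip; apply/simplexP; split => //; first exact: le_trans s1t1.
      by rewrite (le_trans Ss1).
    apply: left_lip; apply/simplexP; split => //; exact: le_trans t1T.
  rewrite (le_trans (ler_distD (Y (m, M) i) _ _))// mulrDr lerD//; last exact: H.
  by rewrite distrC; exact: H.
apply/cvgrPdist_le => e eps0.
have L0 : 0 <= L by rewrite !mulr_ge0// exprn_ge0.
have c : (fun st => L * (e1 st + e3 st + (e2 st + e4 st))) @
    within (simplex S T) (nbhs (s0, t0)) --> L * (0 + 0 + (0 + 0)).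
  have cf1 : {for (s0, t0), continuous (fun st : R * R => st.1)} by exact: cvg_fst.
  have cf2 : {for (s0, t0), continuous (fun st : R * R => st.2)} by exact: cvg_snd.
  have cmin : {for (s0, t0), continuous (fun st : R * R => Num.min st.1 s0)}.
    by apply: continuous_min => //; exact: cvg_cst.
  have cmax : {for (s0, t0), continuous (fun st : R * R => Num.max st.2 t0)}.
    by apply: continuous_max => //; exact: cvg_cst.
  have cst0 (c : R) : {for (s0, t0), continuous (fun st : R * R => c)} by exact: cvg_cst.
  apply: cvgM; first exact: cvg_cst.
  apply: cvgD; apply: cvgD; apply: control_pow_cvg0 => //=;
    rewrite ?minxx ?maxxx// => -[s t] /simplexP[Ss st tT]; apply/simplexP => /=.
  - by rewrite le_min Ss Ss0 ge_min lexx; split => //; exact: le_trans tT.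
  - by rewrite le_max lexx ge_max tT t0T; split => //; exact: le_trans st.
  - rewrite le_min Ss Ss0 ge_min lexx orbT; split => //; exact: le_trans t0T.
  - by rewrite le_max lexx orbT ge_max tT t0T; split => //; exact: le_trans s0t0.
rewrite !addr0 mulr0 in c; move/cvgr0Pnorm_le : c => /(_ _ eps0) c.
near=> st.
have hst : simplex S T st by near: st; exact: withinT.
rewrite distrC (le_trans (near_le _ hst))// (le_trans (ler_norm _))//.
by near: st; exact: c.
Unshelve. all: by end_near. Qed.

End Continuity.

(** * The rough sewing lemma *)

Section RoughSewing.
Context {R : realType} {V : completeNormedModType R} (E : tensor_powers V).
Variables (S T : R) (k : nat).
Implicit Types (X Y Z : R * R -> trunc_alg E k) (w : R * R -> R) (i j : 'I_k.+1).

Let split3 s u t : S <= s -> s <= u -> u <= t -> t <= T ->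
  [/\ simplex S T (s, u), simplex S T (u, t), simplex S T (s, t),
      simplex S T (S, s) & simplex S T (S, u)].
Proof.
move=> Ss su ut tT; split; apply/simplexP; split=> //.
- exact: le_trans tT.
- exact: le_trans su.
- exact: le_trans ut.
- exact: le_trans (le_trans su (le_trans ut tT)).
- exact: le_trans su.
- exact: le_trans tT.
Qed.

Let telescoped_defect (W : zmodType) (A B C d y z : W) :
  A + (B - y) = C + d -> (B - z) + (A - y) - (C - z) = d.
Proof.
move=> e; apply: (@addrI _ C); rewrite -e opprB addrAC [B - z + _]addrA subrK.
by rewrite addrA subrKC addrCA.
Qed.

Let corrected_defect (W : zmodType) (a b c p q x y z : W) :
  y + (a + b - c) + (x + (p - a) - x) + (z + (q - b) - z) = y + (p + q - c).
Proof.
rewrite [x + _]addrC addrK [z + _]addrC addrK -[LHS]addrA -[LHS]addrA; congr (_ + _).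
by rewrite [p - a + _]addrACA -opprD addrC addrA subrK.
Qed.

(** The germ [Xi (s, t)] of level [i = m.+1] is the increment that level [i] of
    [Y (S, s)] gains when [Y (S, s)] is multiplied by [Y (s, t)].  By associativity
    its failure to be additive is exactly the failure of Chen's identity for [Y] at
    level [i].  Hence additive sewing applies, and adding the sewn increment
    minus [Xi] to level [i] restores the identity there without touching the
    lower levels. *)
Lemma multiplicative_step w (C theta theta' : R) (m : nat) Y :
  is_control S T w -> 0 <= C -> 1 <= theta' -> theta' < theta -> (m < k)%N ->
  unital S T Y -> multiplicative_on S T Y m ->
  (forall s u t, S <= s -> s <= u -> u <= t -> t <= T -> forall i, (0 < i)%N ->
    `|trunc_mul (Y (s, u)) (Y (u, t)) i - Y (s, t) i| <= C * w (s, t) `^ theta) ->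
  exists Y' D, [/\ 0 <= D, unital S T Y', multiplicative_on S T Y' m.+1 &
    forall st i, simplex S T st -> `|Y' st i - Y st i| <= D * w st `^ theta'].
Proof.
move=> cw C0 th'1 thth' mk uY mY defY.
pose i : 'I_k.+1 := Ordinal (mk : (m.+1 < k.+1)%N).
pose Xi (st : R * R) : tpow E i := trunc_mul (Y (S, st.1)) (Y st) i - Y (S, st.1) i.
have XiE s u t : S <= s -> s <= u -> u <= t -> t <= T ->
    Xi (s, u) + Xi (u, t) - Xi (s, t) = trunc_mul (Y (s, u)) (Y (u, t)) i - Y (s, t) i.
  move=> Ss su ut tT; have [hsu hut hst hSs hSu] := split3 Ss su ut tT.
  have := congr1 (fun a : trunc_alg E k => a i)
    (trunc_mulA (Y (S, s)) (Y (s, u)) (Y (u, t))).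
  rewrite (@trunc_mul_low _ _ _ _ _ _ (Y (S, u)) (Y (u, t))); last first.
  - by [].
  - by move=> j; rewrite ltnS => jm; apply: mY => //; exact: le_trans tT.
  - exact: uY.
  - exact: uY.
  - exact: uY.
  - by rewrite trunc_mul_ord0// uY.
  rewrite [RHS](@trunc_mul_low _ _ _ _ _ _ (Y (S, s)) (Y (s, t))); last first.
  - by move=> j; rewrite ltnS => jm; apply: mY.
  - by [].
  - exact: uY.
  - exact: uY.
  - by rewrite trunc_mul_ord0// uY.
  - exact: uY.
  by rewrite !subrr !addr0 /Xi/=; exact: telescoped_defect.
have defXi s u t : S <= s -> s <= u -> u <= t -> t <= T ->
    `|Xi (s, u) + Xi (u, t) - Xi (s, t)| <= C * w (s, t) `^ theta.
  by move=> *; rewrite XiE//; exact: defY.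
have [I [Iadd [D D0 ID]]] := additive_sewing cw C0 th'1 thth' defXi.
pose Y' st : trunc_alg E k :=
  dfwith (Y st) i (Y st i + (I st - Xi st)).
have Y'i st : Y' st i = Y st i + (I st - Xi st) by rewrite /Y' dfwithin.
have Y'j st j : j != i -> Y' st j = Y st j by rewrite eq_sym => ?; rewrite /Y' dfwithout.
have Y'low st j : (j < i)%N -> Y' st j = Y st j.
  by move=> ji; apply: Y'j; rewrite -val_eqE/= ltn_eqF.
have uY' : unital S T Y' by move=> st hst; rewrite Y'low ?uY.
exists Y', D; split => //.
- move=> s u t Ss su ut tT j; have [hsu hut hst _ _] := split3 Ss su ut tT.
  rewrite leq_eqVlt => /predU1P[jm|]; last first.
    rewrite ltnS => jm.
    have lowle l : (l <= j)%N -> (l < i)%N by move=> lj; rewrite ltnS (leq_trans lj).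
    rewrite (@trunc_mul_low _ _ _ _ _ _ (Y (s, u)) (Y (u, t))) ?uY ?uY'//.
    + by rewrite !Y'low ?lowle// !subrr !addr0 mY.
    + by move=> l /ltnW lj; rewrite Y'low ?lowle.
    + by move=> l /ltnW lj; rewrite Y'low ?lowle.
  have -> : j = i by exact: val_inj.
  rewrite (@trunc_mul_low _ _ _ _ _ _ (Y (s, u)) (Y (u, t))) ?uY ?uY'//.
  + rewrite !Y'i -(Iadd s u t)//.
    have -> : trunc_mul (Y (s, u)) (Y (u, t)) i =
        Y (s, t) i + (Xi (s, u) + Xi (u, t) - Xi (s, t)).
      by rewrite XiE// subrKC.
    exact: corrected_defect.
  + by move=> l li; rewrite Y'low.
  + by move=> l li; rewrite Y'low.
move=> [s t] j hst; have [->|ji] := eqVneq j i.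
  rewrite Y'i addrC addKr; have /simplexP[? ? ?] := hst; exact: ID.
by rewrite Y'j// subrr normr0 mulr_ge0// powR_ge0.
Qed.

(** The product is Lipschitz on bounded sets, so correcting one level by
    [O(w `^ theta')] changes the defect of the remaining levels by the same order
    and the correction can be repeated at the next level.  Each level costs some
    of the exponent; the midpoint between 1 and the current one stays above 1. *)
Lemma multiplicative_upto w (B C theta : R) Z :
  is_control S T w -> 0 <= B -> 0 <= C -> 1 < theta -> unital S T Z ->
  (forall st i, simplex S T st -> `|Z st i| <= B) ->
  (forall s u t, S <= s -> s <= u -> u <= t -> t <= T -> forall i, (0 < i)%N ->
    `|trunc_mul (Z (s, u)) (Z (u, t)) i - Z (s, t) i| <= C * w (s, t) `^ theta) ->
  forall m, (m <= k)%N -> exists Y theta' D,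
    [/\ 1 < theta' <= theta, 0 <= D, unital S T Y, multiplicative_on S T Y m &
    forall st i, simplex S T st -> `|Y st i - Z st i| <= D * w st `^ theta'].
Proof.
move=> cw B0 C0 th1 uZ ZB defZ; elim=> [|m IH] mk.
  exists Z, theta, 0; split => //.
  - by rewrite th1 lexx.
  - move=> s u t Ss su ut tT i; rewrite leqn0 => /eqP i0.
    have [hsu hut hst _ _] := split3 Ss su ut tT.
    have -> : i = ord0 by exact: val_inj.
    by rewrite trunc_mul_ord0 ?uZ.
  - by move=> st i _; rewrite subrr normr0 mul0r.
have [Y [th [D [/andP[th1' thle] D0 uY mY YZ]]]] := IH (ltnW mk).
set W := w (S, T).
pose B' := B + D * W `^ th.
have th0 : 0 <= th by rewrite ltW// (lt_trans ltr01).
have DW0 : 0 <= D * W `^ th by rewrite mulr_ge0// powR_ge0.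
have B'0 : 0 <= B' by rewrite addr_ge0.
have YB st i : simplex S T st -> `|Y st i| <= B'.
  case: st => s t hst; rewrite -(subrK (Z (s, t) i) (Y (s, t) i)) addrC.
  rewrite (le_trans (ler_normD _ _))// lerD ?ZB//.
  rewrite (le_trans (YZ _ _ hst))// ler_wpM2l//.
  by have /andP[? ?] := control_leST cw hst; rewrite ler_powR_base.
have ZB' st i : simplex S T st -> `|Z st i| <= B'.
  by move=> hst; rewrite (le_trans (ZB _ _ hst))// lerDl.
pose C' := k.+1%:R ^+ 2 * (2 * B' * D) + (C * W `^ (theta - th) + D).
have C'0 : 0 <= C'.
  by rewrite !addr_ge0 ?mulr_ge0 ?powR_ge0// exprn_ge0.
have defY s u t : S <= s -> s <= u -> u <= t -> t <= T -> forall i, (0 < i)%N ->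
    `|trunc_mul (Y (s, u)) (Y (u, t)) i - Y (s, t) i| <= C' * w (s, t) `^ th.
  move=> Ss su ut tT i i0; have [hsu hut hst _ _] := split3 Ss su ut tT.
  have /andP[wsu0 _] := control_leST cw hsu.
  have /andP[wut0 _] := control_leST cw hut.
  have /andP[wst0 wW] := control_leST cw hst.
  rewrite (le_trans (ler_distD (trunc_mul (Z (s, u)) (Z (u, t)) i) _ _))//.
  rewrite mulrDl lerD//.
    rewrite -mulrA -[_ * D * _]mulrA; apply: trunc_mul_lip.
    - exact: B'0.
    - by rewrite mulr_ge0// powR_ge0.
    - by move=> j; exact: YB.
    - by move=> j; exact: YB.
    - by move=> j; exact: ZB'.
    - by move=> j; exact: ZB'.
    - move=> j; rewrite (le_trans (YZ _ _ hsu))// ler_wpM2l// ler_powR_base//.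
      exact: (control_le cw).
    - move=> j; rewrite (le_trans (YZ _ _ hut))// ler_wpM2l// ler_powR_base//.
      exact: (control_le cw).
  rewrite (le_trans (ler_distD (Z (s, t) i) _ _))// mulrDl lerD//.
    rewrite (le_trans (defZ _ _ _ Ss su ut tT _ i0))// -mulrA ler_wpM2l//.
    exact: (control_pow_le cw).
  by rewrite distrC YZ.
pose th' := (1 + th) / 2.
have th'1 : 1 < th' by rewrite /th'; lra.
have th'th : th' < th by rewrite /th'; lra.
have [Y' [D' [D'0 uY' mY' Y'Y]]] :=
  multiplicative_step cw C'0 (ltW th'1) th'th mk uY mY defY.
exists Y', th', (D' + D * W `^ (th - th')); split => //.
- by rewrite th'1 (le_trans (ltW th'th)).
- by rewrite addr_ge0// mulr_ge0// powR_ge0.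
move=> [s t] i hst; rewrite (le_trans (ler_distD (Y (s, t) i) _ _))//.
rewrite mulrDl lerD ?Y'Y//.
rewrite (le_trans (YZ _ _ hst))// -mulrA ler_wpM2l//.
have /andP[? ?] := control_leST cw hst.
apply: (control_pow_le cw) => //; last exact: ltW.
by rewrite ltW// (lt_trans ltr01).
Qed.

Lemma Omega_am_exponent p w (theta theta' : R) Z : is_control S T w -> 1 <= p ->
  0 <= theta' -> theta' <= theta -> Omega_am S T p theta w Z -> Omega_am S T p theta' w Z.
Proof.
move=> cw p1 th'0 thth' [uZ [K [K0 pZ dZ]]]; split => //.
pose M := w (S, T) `^ (theta - theta').
have M0 : 0 <= M by exact: powR_ge0.
exists (K + K * M); split.
- by rewrite addr_ge0// mulr_ge0.
- apply: pvar_controlled_le pZ => //; first by rewrite lerDl mulr_ge0.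
  by move=> [s t] hst; have /andP[-> _] := control_leST cw hst; rewrite lexx.
move=> s u t Ss su ut tT i i0; have [_ _ hst _ _] := split3 Ss su ut tT.
rewrite (le_trans (dZ _ _ _ Ss su ut tT _ i0))//.
have /andP[? ?] := control_leST cw hst.
apply: (@le_trans _ _ (K * M * w (s, t) `^ theta')).
  by rewrite -mulrA ler_wpM2l//; exact: (control_pow_le cw).
by rewrite ler_wpM2r ?powR_ge0// lerDr.
Qed.

(** Lyons' rough sewing lemma, with an exponent that may be smaller than the
    initial one. *)
Lemma rough_sewing p w (theta : R) Z : is_control S T w -> 1 <= p -> k%:R <= p ->
  1 < theta -> Omega_am S T p theta w Z ->
  exists Y theta' C, [/\ 1 < theta' <= theta, Omega_am S T p theta' w Z,
    Omega S T p Y, 0 <= C & forall st i, simplex S T st -> (0 < i)%N ->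
      `|Y st i - Z st i| <= C * w st `^ theta'].
Proof.
move=> cw p1 kp th1 hZ; have [uZ [K [K0 pZ dZ]]] := hZ.
have p0 : 0 < p by exact: lt_le_trans p1.
have [N N0 ZN] := pvar_bound cw p1 K0 pZ.
pose B := 1 + N * w (S, T) `^ p^-1.
have B0 : 0 <= B by rewrite addr_ge0// mulr_ge0// powR_ge0.
have ZB st i : simplex S T st -> `|Z st i| <= B.
  apply: norm_unital_le; rewrite ?mulr_ge0 ?powR_ge0// => -[s t] j hst j0.
  rewrite (le_trans (ZN _ _ hst j0))// ler_wpM2l//.
  have /andP[? ?] := control_leST cw hst.
  by rewrite ler_powR_base// invr_ge0 ltW.
have [Y [th [D [/andP[th1' thle] D0 uY mY YZ]]]] :=
  multiplicative_upto cw B0 K0 th1 uZ ZB dZ (leqnn k).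
have th0 : 0 <= th by rewrite ltW// (lt_trans ltr01).
have YZ' st i : simplex S T st -> (0 < i)%N -> `|Y st i - Z st i| <= D * w st `^ th.
  by move=> hst _; exact: YZ.
have [L L0 pYZ] := pvar_controlled_pow (Z := fun st i => Y st i - Z st i)
  cw p1 kp (ltW th1') D0 YZ'.
have pY : pvar_controlled S T p w (K + L) Y.
  apply: (pvar_controlledD pZ pYZ) => st i hst i0.
  by rewrite -{1}(subrK (Z st i) (Y st i)) addrC ler_normD.
exists Y, th, D; split => //.
- by rewrite th1' thle.
- exact: Omega_am_exponent hZ.
split; last by exists w, (K + L); split => //; exact: addr_ge0.
split => //.
  by apply: (multiplicative_continuous cw p1 _ uY mY pY); exact: addr_ge0.
move=> s u t Ss su ut tT; apply: functional_extensionality_dep => i.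
by apply: mY => //; rewrite -ltnS.
Qed.

End RoughSewing.

(** * The H-space and the almost H-space *)

Section AlmostHspace.
Context {R : realType} {V : completeNormedModType R} (E : tensor_powers V).
Variables (S T p : R).
Hypothesis p1 : 1 <= p.
Let k := Num.truncn p.
Implicit Types (X Y Z H : R * R -> trunc_alg E (Num.truncn p)).

Let p0 : 0 < p. Proof. exact: lt_le_trans p1. Qed.
Let kp : k%:R <= p. Proof. by rewrite truncn_le ltW. Qed.

(** A multiplicative functional has no defect at all, so any exponent above 1
    serves; the controls of the [p]-variation and of the level bound are added. *)
Lemma Hspace_sub_almost : Hspace E S T p `<=` almost_Hspace E S T p.
Proof.
move=> H [[[cH uH mH] [w0 [K0 [cw0 K00 pH]]]] [w [phi [K [cw /andP[phi1 phi2] K1 lH]]]]].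
have phi0 : 0 <= phi.
  by rewrite ltW// (le_lt_trans _ phi1)// subr_ge0 invf_le1.
exists (fun st => w0 st + w st), 2, phi, (K + 1); split.
- exact: is_controlD.
- by rewrite ltr1n.
- by rewrite phi1 phi2.
- by rewrite ltr_wpDl.
split; last first.
  move=> i i0 st hst; rewrite (le_trans (lH i i0 _ hst))//.
  have /andP[wst wle] := control_addr cw0 cw hst.
  by rewrite ler_pM ?powR_ge0 ?lerDl// ler_powR_base.
split => //; exists K0; split => //.
- by apply: pvar_controlled_le pH => // st hst; exact: (control_addl cw0 cw).
- by move=> s u t Ss su ut tT i i0; rewrite mH// subrr normr0 mulr_ge0// powR_ge0.
Qed.

Lemma oplus_pos X H st (i : 'I_k.+1) : (0 < i)%N -> oplus X H st i = X st i + H st i.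
Proof. by rewrite /oplus; case: eqP => // ->. Qed.

Lemma oplus_unital X H : unital S T (oplus X H).
Proof. by []. Qed.

Let oplus_defect (W : zmodType) (a b c d f g h l z : W) :
  a + b + (c + d) + (f + g + (h + l)) - (a + c + f + z) =
  b + d + l - z + (g + h).
Proof.
rewrite [a + b + _]addrACA -[f + g + _]addrA [g + (h + l)]addrA [_ + (f + _)]addrACA.
by rewrite opprD [LHS]addrACA subrr add0r [g + h + l]addrC addrA addrAC.
Qed.

(** The defect of the sum is the defect of [H] plus the two cross terms between [X]
    and [H], which are of order [w `^ (p^-1 + phi)]; the condition
    [phi > 1 - p^-1] is exactly that this exponent exceeds 1. *)
Lemma oplus_almost X H : rough_path E S T p X -> almost_Hspace E S T p H ->
  exists w theta, [/\ is_control S T w, 1 < theta & Omega_am S T p theta w (oplus X H)].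
Proof.
move=> [[cX uX mX] [wX [KX [cwX KX0 pX]]]].
move=> [w0 [th [phi [K [cw0 th1 /andP[phi1 phi2] K0 [[uH [KH [KH0 pH dH]]] lH]]]]]].
pose w st := wX st + w0 st.
have cw : is_control S T w by exact: is_controlD.
have wXw st : simplex S T st -> 0 <= wX st <= w st by exact: control_addl.
have w0w st : simplex S T st -> 0 <= w0 st <= w st by exact: control_addr.
have q0 : 0 < p^-1 by rewrite invr_gt0.
have phi0 : 0 < phi by rewrite (le_lt_trans _ phi1)// subr_ge0 invf_le1.
have pX' : pvar_controlled S T p w KX X by exact: pvar_controlled_le pX.
have pH' : pvar_controlled S T p w KH H by exact: pvar_controlled_le pH.
have [N N0 XN] := pvar_bound cw p1 KX0 pX'.
have HK st (j : 'I_k.+1) : simplex S T st -> (0 < j)%N -> `|H st j| <= K * w st `^ phi.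
  move=> hst j0; rewrite (le_trans (lH j j0 _ hst))// ler_wpM2l ?(ltW K0)//.
  by have /andP[? ?] := w0w _ hst; rewrite ler_powR_base// ltW.
pose th' := Num.min th (p^-1 + phi).
have th'1 : 1 < th' by rewrite lt_min th1/=; rewrite ltrBlDl in phi1.
have th'0 : 0 <= th' by rewrite ltW// (lt_trans ltr01).
exists w, th'; split => //; split; first exact: oplus_unital.
pose W := w (S, T).
pose M1 := KH * W `^ (th - th').
pose M2 := k.+1%:R ^+ 2 * (N * K) * W `^ (p^-1 + phi - th').
have M10 : 0 <= M1 by rewrite mulr_ge0// powR_ge0.
have NK0 : 0 <= k.+1%:R ^+ 2 * (N * K).
  by rewrite mulr_ge0 ?exprn_ge0// mulr_ge0// ltW.
have M20 : 0 <= M2 by rewrite mulr_ge0// powR_ge0.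
exists (KX + KH + (M1 + M2 + M2)); split.
- by rewrite !addr_ge0.
- apply: (@pvar_controlled_le _ _ _ _ _ _ p w w (KX + KH)) => //.
  + by rewrite lerDl !addr_ge0.
  + by rewrite addr_ge0.
  + by move=> st hst; rewrite lexx andbT; have [_ w_ge0 _ _] := cw; exact: w_ge0.
  + apply: (pvar_controlledD pX' pH') => st i hst i0.
    by rewrite oplus_pos// ler_normD.
move=> s u t Ss su ut tT i i0.
have hst : simplex S T (s, t).
  by apply/simplexP; split => //; exact: le_trans ut.
have hsu : simplex S T (s, u).
  by apply/simplexP; split => //; exact: le_trans tT.
have hut : simplex S T (u, t).
  by apply/simplexP; split => //; exact: le_trans su.
have in0 : i != ord0 by rewrite -val_eqE/= -lt0n.
have /andP[wsu0 _] := control_leST cw hsu.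
have /andP[wut0 _] := control_leST cw hut.
have /andP[wst0 wW] := control_leST cw hst.
have wsut : w (s, u) <= w (s, t) by exact: (control_le cw).
have wutt : w (u, t) <= w (s, t) by exact: (control_le cw).
have -> : trunc_mul (oplus X H (s, u)) (oplus X H (u, t)) i - oplus X H (s, t) i =
    (trunc_mul (H (s, u)) (H (u, t)) i - H (s, t) i) +
    (cross (X (s, u)) (H (u, t)) i + cross (H (s, u)) (X (u, t)) i).
  rewrite trunc_mul_unital ?oplus_unital// !oplus_pos// -(mX s u t)//.
  rewrite !trunc_mul_unital ?uX ?uH//.
  rewrite (@eq_cross _ _ _ _ _ _ (fun j => X (s, u) j + H (s, u) j)
    (fun j => X (u, t) j + H (u, t) j)); last 2 first.
  - by move=> j /andP[j0 _]; rewrite oplus_pos.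
  - by move=> j /andP[j0 _]; rewrite oplus_pos.
  rewrite crossDl !crossDr.
  exact: oplus_defect.
rewrite (le_trans (ler_normD _ _))// (le_trans (lerD (lexx _) (ler_normD _ _)))//.
have M_le : M1 + M2 + M2 <= KX + KH + (M1 + M2 + M2) by rewrite lerDr addr_ge0.
apply: (le_trans _ (ler_wpM2r (powR_ge0 _ _) M_le)).
rewrite [leRHS]mulrDl mulrDl addrA.
have step x r : 0 <= x -> x <= w (s, t) -> 0 <= r -> x `^ r <= w (s, t) `^ r.
  by move=> *; exact: ler_powR_base.
have cross_le (a b : trunc_alg E k) :
    (forall j : 'I_k.+1, (0 < j)%N -> `|a j| <= N * w (s, t) `^ p^-1) ->
    (forall j : 'I_k.+1, (0 < j)%N -> `|b j| <= K * w (s, t) `^ phi) ->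
    `|cross a b i| <= M2 * w (s, t) `^ th' /\ `|cross b a i| <= M2 * w (s, t) `^ th'.
  move=> aN bK.
  have NKE : k.+1%:R ^+ 2 * ((N * w (s, t) `^ p^-1) * (K * w (s, t) `^ phi)) <=
      M2 * w (s, t) `^ th'.
    rewrite [N * _ * _]mulrACA -powRD_gt0 ?(ltW q0)// mulrA /M2 -[leRHS]mulrA ler_wpM2l//.
    by apply: (control_pow_le cw) => //; rewrite ge_min lexx orbT.
  split; rewrite (le_trans _ NKE)//.
    by apply: norm_cross => //; rewrite mulr_ge0 ?powR_ge0// ltW.
  rewrite [N * _ * _]mulrC; apply: norm_cross => //; rewrite mulr_ge0 ?powR_ge0//.
  exact: ltW.
have XN' x y : simplex S T (x, y) -> w (x, y) <= w (s, t) ->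
    forall j : 'I_k.+1, (0 < j)%N -> `|X (x, y) j| <= N * w (s, t) `^ p^-1.
  move=> hxy wxy j j0; rewrite (le_trans (XN _ _ hxy j0))// ler_wpM2l// step//.
    by have /andP[] := control_leST cw hxy.
  exact: ltW.
have HK' x y : simplex S T (x, y) -> w (x, y) <= w (s, t) ->
    forall j : 'I_k.+1, (0 < j)%N -> `|H (x, y) j| <= K * w (s, t) `^ phi.
  move=> hxy wxy j j0; rewrite (le_trans (HK _ _ hxy j0))// ler_wpM2l ?(ltW K0)// step//.
    by have /andP[] := control_leST cw hxy.
  exact: ltW.
rewrite lerD//; last by apply: (cross_le _ _ _ _).2; [exact: XN'|exact: HK'].
rewrite lerD//; last by apply: (cross_le _ _ _ _).1; [exact: XN'|exact: HK'].
rewrite (le_trans (dH s u t Ss su ut tT i i0))// -mulrA ler_wpM2l//.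
have /andP[? ?] := w0w _ hst.
by apply: (control_pow_le cw) => //; rewrite ge_min lexx.
Qed.

Lemma boxplus_sewing X H : rough_path E S T p X -> almost_Hspace E S T p H ->
  is_sewing S T (oplus X H) (boxplus S T X H).
Proof.
move=> hX hH; apply: xgetPex.
have [w [th [cw th1 hXH]]] := oplus_almost hX hH.
have [Y [th' [C [/andP[th'1 _] am OY C0 hY]]]] := rough_sewing cw p1 kp th1 hXH.
exists Y, p, th', w; split => //; split => //.
by exists C => st hst i i0; exact: hY.
Qed.

(** The two sewings may come with unrelated exponents and controls; they are
    compared under the sum of the controls and the least of the exponents. *)
Lemma boxplus_eq X H H' w (theta C : R) : rough_path E S T p X ->
  almost_Hspace E S T p H -> almost_Hspace E S T p H' ->
  is_control S T w -> 1 < theta -> 0 <= C ->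
  (forall st (i : 'I_k.+1), simplex S T st -> (0 < i)%N ->
    `|H st i - H' st i| <= C * w st `^ theta) ->
  forall st, simplex S T st -> boxplus S T X H st = boxplus S T X H' st.
Proof.
move=> hX hH hH' cw th1 C0 HH'.
have [p2 [th2 [w2 [_ th21 cw2 _ [[[_ uY mY] _] [C2 hY]]]]]] := boxplus_sewing hX hH.
have [p3 [th3 [w3 [_ th31 cw3 _ [[[_ uY' mY'] _] [C3 hY']]]]]] := boxplus_sewing hX hH'.
set Y := boxplus _ _ _ H in uY mY hY *; set Y' := boxplus _ _ _ H' in uY' mY' hY' *.
pose v st := w2 st + (w3 st + w st).
have cv' : is_control S T (fun st => w3 st + w st) by exact: is_controlD.
have cv : is_control S T v by exact: is_controlD.
pose th' := Num.min th2 (Num.min th3 theta).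
have th'1 : 1 < th' by rewrite !lt_min th21 th31.
have th'0 : 0 <= th' by rewrite ltW// (lt_trans ltr01).
pose W := v (S, T).
pose D := `|C2| * W `^ (th2 - th') + (C * W `^ (theta - th') + `|C3| * W `^ (th3 - th')).
have D0 : 0 <= D by rewrite !addr_ge0// mulr_ge0// powR_ge0.
have bound (c x t1 s t : R) : 0 <= c -> simplex S T (s, t) -> 0 <= x <= v (s, t) ->
    th' <= t1 -> c * x `^ t1 <= c * W `^ (t1 - th') * v (s, t) `^ th'.
  move=> c0 hst /andP[x0 xv] tt; rewrite -mulrA ler_wpM2l//.
  exact: (control_pow_le cv).
apply: (multiplicative_unique cv D0 th'1 uY uY').
- by move=> s u t Ss su ut tT i _; rewrite mY.
- by move=> s u t Ss su ut tT i _; rewrite mY'.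
move=> [s t] i hst i0.
rewrite (le_trans (ler_distD (oplus X H (s, t) i) _ _))// mulrDl lerD//.
  rewrite (le_trans (hY _ hst i i0))//.
  rewrite (le_trans (ler_wpM2r (powR_ge0 _ _) (ler_norm C2)))// bound//.
    exact: (control_addl cw2 cv' hst).
  by rewrite ge_min lexx.
rewrite (le_trans (ler_distD (oplus X H' (s, t) i) _ _))// mulrDl lerD//.
  rewrite !oplus_pos// opprD addrACA subrr add0r (le_trans (HH' _ _ hst i0))//.
  rewrite bound//.
    have /andP[? h] := control_addr cw3 cw hst.
    by have /andP[_ h'] := control_addr cw2 cv' hst; apply/andP; split => //; exact: le_trans h'.
  by rewrite !ge_min lexx !orbT.
rewrite distrC (le_trans (hY' _ hst i i0))//.
rewrite (le_trans (ler_wpM2r (powR_ge0 _ _) (ler_norm C3)))// bound//.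
  have /andP[? h] := control_addl cw3 cw hst.
  by have /andP[_ h'] := control_addr cw2 cv' hst; apply/andP; split => //; exact: le_trans h'.
by rewrite !ge_min lexx !orbT.
Qed.

(** The sewing of [H] differs from [H] by [O(w `^ theta)] with [theta > 1 >= phi],
    so the bound of order [phi] on the levels survives. *)
Lemma almost_Hspace_sewing H : almost_Hspace E S T p H ->
  exists Y w theta C, [/\ Hspace E S T p Y, is_control S T w, 1 < theta, 0 <= C &
    forall st (i : 'I_k.+1), simplex S T st -> (0 < i)%N ->
      `|Y st i - H st i| <= C * w st `^ theta].
Proof.
move=> [w [th [phi [K [cw th1 /andP[phi1 phi2] K0 [amH lH]]]]]].
have [Y [th' [C [/andP[th'1 _] _ OY C0 hY]]]] := rough_sewing cw p1 kp th1 amH.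
have phi0 : 0 < phi by rewrite (le_lt_trans _ phi1)// subr_ge0 invf_le1.
exists Y, w, th', C; split => //; split => //.
exists w, phi, (C * w (S, T) `^ (th' - phi) + K); split => //.
- by rewrite phi1.
- by rewrite addr_ge0 ?(ltW K0)// mulr_ge0// powR_ge0.
move=> i i0 [s t] hst; rewrite -(subrK (H (s, t) i) (Y (s, t) i)).
rewrite (le_trans (ler_normD _ _))// mulrDl lerD ?lH//.
rewrite (le_trans (hY _ _ hst i0))// -mulrA ler_wpM2l//.
have /andP[? ?] := control_leST cw hst.
apply: (control_pow_le cw) => //; first exact: ltW.
by rewrite ltW// (le_lt_trans phi2).
Qed.

End AlmostHspace.

Theorem mainTheorem7 (R : realType) (V : completeNormedModType R)
    (E : tensor_powers V) (S T : R) (hST : S <= T) (p : R) (hp : 1 <= p)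
    (X : R * R -> trunc_alg E (Num.truncn p)) (hX : rough_path E S T p X) :
  [set on_simplex S T (boxplus S T X H) | H in Hspace E S T p] =
  [set on_simplex S T (boxplus S T X H) | H in almost_Hspace E S T p].
Proof.
apply/seteqP; split=> [Y [H hH <-]|Y [H hH <-]].
  by exists H => //; exact: (Hspace_sub_almost hp).
(* the witness is the sewing of [H] itself *)
have [H' [w [th [C [hH' cw th1 C0 H'H]]]]] := almost_Hspace_sewing hp hH.
exists H' => //; apply/funext => st; rewrite /on_simplex /patch.
case: ifPn => // /set_mem hst.
exact: (boxplus_eq hp hX (Hspace_sub_almost hp hH') hH cw th1 C0 H'H).
Qed.
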